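(* Let $K$ be a difference field of characteristic $0$ such that $C_K$ is algebraically closed, let $A\in\mathrm{GL}_n(K)$, let $R=K[Y,\det(Y)^{-1}]$ where $Y=(Y_{i,j})$ is an $n\times n$ matrix of indeterminates and $\sigma(Y)=AY$, let $L$ be the field of fractions of $R$, and let $R'$ be a Picard-Vessiot ring for $\sigma(X)=AX$ over $K$. Then $\ell(R')=[D_L:C_L]$.
   Context: A difference ring (field) is a commutative ring with $1$ (a field) with a distinguished automorphism $\sigma$. For a difference ring $S$: $C_S=\{a\in S:\sigma(a)=a\}$, $D_S=\{a\in S:\sigma^m(a)=a\text{ for some }m\neq0\}$. A Picard-Vessiot ring for $\sigma(X)=AX$ over $K$ is a difference ring extension $R'=K[y,\det(y)^{-1}]$ of $K$, with $y\in\mathrm{GL}_n(R')$, $\sigma(y)=Ay$, having no $\sigma$-invariant ideals other than $(0)$ and $R'$. Such a ring decomposes as $R'=\bigoplus_{i=0}^{\ell-1}e_iR'$, where the $e_i=\sigma^i(e_0)$ are the primitive idempotents of $R'$ and each $e_iR'$ is a domain stable under $\sigma^\ell$; $\ell(R')=\ell$ is the number of primitive idempotents of $R'$. *)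

(* Defs.v *)
From HB Require Import structures.
From mathcomp Require Import all_boot all_order all_algebra.
From mathcomp Require Export fraction.
From mathcomp Require Import mpoly.

Set Implicit Arguments.
Unset Strict Implicit.
Unset Printing Implicit Defensive.

Import GRing.Theory.
Local Open Scope ring_scope.

Section Sigma.
Variables (S : nzRingType) (sigma : S -> S).

(* The constants C_S. *)
Definition fixed (a : S) : Prop := sigma a = a.

(* The periodic elements D_S.  As sigma is an automorphism,
   sigma^m a = a iff sigma^(-m) a = a, so positive m suffice. *)
Definition periodic (a : S) : Prop :=
  exists m : nat, (0 < m)%N /\ iter m sigma a = a.

(* [idealr_closed] describes the ideals that do not contain 1, so this says
   that 0 and S are the only ideals I with sigma(I) contained in I. *)
Definition sigma_simple : Prop :=
  forall I : {pred S}, idealr_closed I ->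
    (forall a, a \in I -> sigma a \in I) -> I =i pred1 0.

End Sigma.

Definition alg_closed_in (K : fieldType) (C : K -> Prop) : Prop :=
  forall p : {poly K}, (forall i, C p`_i) -> (1 < size p)%N ->
    exists2 x, C x & root p x.

Section Extension.
Variables (K : fieldType) (n : nat).

(* p(y) for p a polynomial over K in n * n variables, indexed row by row. *)
Definition mx_eval (S : comUnitRingType) (iota : K -> S) (y : 'M[S]_n)
    (p : {mpoly K[n * n]}) : S :=
  mmap iota (fun k => mxvec y 0 k) p.

(* S, with structure map iota, is a difference ring extension of (K, sigma) and
   S = K[y, 1/det y] with y in GL_n(S) and sigma(y) = A y. *)
Record fundamental_extension (sigma : {rmorphism K -> K}) (A : 'M[K]_n)
    (S : comUnitRingType) (sigmaS : {rmorphism S -> S})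
    (iota : {rmorphism K -> S}) (y : 'M[S]_n) : Prop := {
  fundext_bij : bijective sigmaS;
  fundext_iota : forall a, sigmaS (iota a) = iota (sigma a);
  fundext_unit : y \in unitmx;
  fundext_eq : map_mx sigmaS y = map_mx iota A *m y;
  fundext_gen : forall x : S, exists (p : {mpoly K[n * n]}) (k : nat),
    x = mx_eval iota y p / \det y ^+ k }.

Definition alg_independent (S : comUnitRingType) (iota : K -> S)
    (y : 'M[S]_n) : Prop :=
  forall p : {mpoly K[n * n]}, mx_eval iota y p = 0 -> p = 0.

Definition picard_vessiot (sigma : {rmorphism K -> K}) (A : 'M[K]_n)
    (S : comUnitRingType) (sigmaS : {rmorphism S -> S})
    (iota : {rmorphism K -> S}) : Prop :=
  (exists y : 'M[S]_n, fundamental_extension sigma A sigmaS iota y) /\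
  sigma_simple sigmaS.

End Extension.

Definition primitive_idempotent (S : comNzRingType) (e : S) : Prop :=
  [/\ e != 0, e * e = e &
      forall f g : S, f * f = f -> g * g = g -> f * g = 0 -> e = f + g ->
        f = 0 \/ g = 0].

Definition has_card (T : eqType) (P : T -> Prop) (d : nat) : Prop :=
  exists s : seq T, [/\ uniq s, size s = d & forall x, x \in s <-> P x].

(* [E : F] = d, for subfields F <= E of L: E has an F-basis with d elements. *)
Definition has_degree (L : fieldType) (E F : L -> Prop) (d : nat) : Prop :=
  exists b : 'I_d -> L,
    [/\ forall i, E (b i),
        forall x, E x ->
          exists2 c : 'I_d -> L, forall i, F (c i) & x = \sum_i c i * b i
      & forall c : 'I_d -> L, (forall i, F (c i)) ->
          \sum_i c i * b i = 0 -> forall i, c i = 0].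

(* Main.v *)
(** Let [s] be the automorphism of [R'].  As [R'] is Noetherian, it has a prime
ideal [P = Ann x]; simplicity of [R'] makes finitely many conjugates of [P]
intersect in 0, so [s^l P = P] for some [l > 0], and for the least such [l] the
ring [R'] is the direct sum of [l] domains cyclically permuted by [s].

Upper bound: the [s^m]-constants of the domain [R'/P] lie in [C_K], since the
differences [c - a] of a transcendental element [c] with the elements [a] of [K]
are units for finitely many [a] only.  If [a = p/q] in [L] has period [m], with
[l | m], then along every specialization [Y |-> y g] with [g] an invertible matrix
of natural numbers its value in [Frac (R'/P)] is a constant; these
specializations are dense, whence [sigma^l a = a].

Lower bound: embed [L] and [R'/P] over [K] in a common field [F].  As [y] and [Y]
differ by a constant matrix, the sequence [i |-> s^i e mod P] has the form
[sum_j sigma^i(lam_j) b_j] with [lam_j] in [L] and [b_j] in [F].  For [e] a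
primitive idempotent and a shortest such expression the [lam_j] are fixed by
[sigma^l], and since the sequences of the [l] conjugates of [e] are linearly
independent, so are the [l] embeddings [sigma^i] on the field fixed by [sigma^l]. *)

From HB Require Import structures.
Require Import Defs.
From mathcomp Require Import all_boot all_order all_algebra.
From mathcomp Require Import boolp ring_quotient mpoly ring.

Set Implicit Arguments.
Unset Strict Implicit.
Unset Printing Implicit Defensive.

Import GRing.Theory.
Local Open Scope ring_scope.

(** * Noetherian rings *)

Section Noetherian.

Inductive gen (S : comNzRingType) (B : S -> Prop) : S -> Prop :=
| gen_zero : gen B 0
| gen_step c a x : B a -> gen B x -> gen B (c * a + x).

(** The ascending chain condition for the ideals of initial segments of a sequence. *)
Definition noetherian (S : comNzRingType) : Prop :=
  forall a : nat -> S,
    exists n, gen (fun x => exists2 i, (i < n)%N & x = a i) (a n).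

Section Gen.
Variable S : comNzRingType.
Implicit Types (B : S -> Prop) (x y c : S).

Lemma gen_in B x : B x -> gen B x.
Proof.
move=> Bx; rewrite -[x]mul1r -[_ * _]addr0.
by apply: gen_step => //; apply: gen_zero.
Qed.

Lemma genD B x y : gen B x -> gen B y -> gen B (x + y).
Proof.
move=> gx gy; elim: gx => [|c a z Ba _ IH]; first by rewrite add0r.
by rewrite -addrA; apply: gen_step.
Qed.

Lemma genM B c x : gen B x -> gen B (c * x).
Proof.
elim=> [|d a z Ba _ IH]; first by rewrite mulr0; apply: gen_zero.
by rewrite mulrDr mulrA; apply: gen_step.
Qed.

Lemma genB B x y : gen B x -> gen B y -> gen B (x - y).
Proof. by move=> gx gy; rewrite -mulN1r; apply/genD/genM. Qed.

Lemma gen_trans B B' x : (forall a, B a -> gen B' a) -> gen B x -> gen B' x.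
Proof.
move=> BB'; elim=> [|c a z Ba _ IH]; first exact: gen_zero.
by apply: genD => //; apply/genM/BB'.
Qed.

Lemma gen_sub B B' x : (forall a, B a -> B' a) -> gen B x -> gen B' x.
Proof. by move=> BB'; apply: gen_trans => a /BB'; apply: gen_in. Qed.

Lemma gen_ann B a x : (forall b, B b -> a * b = 0) -> gen B x -> a * x = 0.
Proof.
move=> aB; elim=> [|c b y Bb _ IH]; first by rewrite mulr0.
by rewrite mulrDr IH mulrCA aB // mulr0 addr0.
Qed.

End Gen.

Lemma gen_map (S T : comNzRingType) (f : {rmorphism S -> T}) (B : S -> Prop)
    (x : S) :
  gen B x -> gen (fun t => exists2 a, B a & t = f a) (f x).
Proof.
elim=> [|c a z Ba _ IH]; first by rewrite rmorph0; apply: gen_zero.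
by rewrite rmorphD rmorphM; apply: gen_step => //; exists a.
Qed.

Lemma noetherian_field (K : fieldType) : noetherian K.
Proof.
move=> a; have [a0|a0] := eqVneq (a 0%N) 0.
  by exists 0%N; rewrite a0; apply: gen_zero.
exists 1%N; rewrite -[a 1%N](divfK a0); apply: genM; apply: gen_in.
by exists 0%N.
Qed.

Lemma noetherian_image (S T : comNzRingType) (f : {rmorphism S -> T}) :
  (forall t, exists s, f s = t) -> noetherian S -> noetherian T.
Proof.
move=> fsurj noeS a; have [b fb] := choice (fun i => fsurj (a i)).
have [n gn] := noeS b; exists n; rewrite -fb.
by apply: gen_sub (gen_map f gn) => _ [_ [i ltin ->] ->]; exists i; rewrite ?fb.
Qed.

(** Multiplying the generators by powers of ['X] brings them all to degree [m], where their leading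
    coefficients combine. *)
Lemma gen_lead_coef (S : comNzRingType) (B : {poly S} -> Prop) (m : nat)
    (x : S) :
  (forall q, B q -> q != 0 /\ (size q <= m.+1)%N) ->
  gen (fun a => exists2 q, B q & a = lead_coef q) x ->
  exists r, [/\ gen B r, (size r <= m.+1)%N & r`_m = x].
Proof.
move=> BP; elim=> [|c a z [q Bq ->] _ [r [gr szr rm]]].
  by exists 0; split; rewrite ?size_poly0 ?coef0 //; apply: gen_zero.
have [q0 szq] := BP q Bq.
exists (c%:P * 'X^(m.+1 - size q) * q + r); split; first exact: gen_step.
  apply: leq_trans (size_polyD _ _) _; rewrite geq_max szr andbT -mulrA.
  rewrite mul_polyC (leq_trans (size_scale_leq _ _)) //.
  by rewrite mulrC size_mulXn // subnK.
rewrite coefD rm -mulrA coefCM coefXnM lead_coefE.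
move: szq; rewrite -size_poly_gt0 in q0; case: (size q) q0 => // k _.
by rewrite ltnS subSS => lekm; rewrite ltnNge leq_subr /= subKn.
Qed.

Lemma gen_range_stage (S : comNzRingType) (a : nat -> S) (g : S) :
  gen (fun x => exists i, x = a i) g ->
  exists n, gen (fun x => exists2 i, (i < n)%N & x = a i) g.
Proof.
elim=> [|c _ x [i ->] _ [n gx]]; first by exists 0%N; apply: gen_zero.
exists (maxn i.+1 n); apply: gen_step; first by exists i; rewrite ?leq_maxl.
apply: gen_sub gx => _ [j ltjn ->]; exists j => //.
by rewrite (leq_trans ltjn) ?leq_maxr.
Qed.

Lemma noetherian_fg (S : comNzRingType) (a : nat -> S) :
  (exists2 gs : seq S, forall g, g \in gs -> gen (fun x => exists i, x = a i) g &
    forall i, gen (fun x => x \in gs) (a i)) ->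
  exists n, gen (fun x => exists2 i, (i < n)%N & x = a i) (a n).
Proof.
move=> [gs gsI Igs].
suff [n nP] : exists n, forall g, g \in gs ->
    gen (fun x => exists2 i, (i < n)%N & x = a i) g.
  by exists n; apply: gen_trans (Igs n).
elim: gs gsI {Igs} => [|g gs IH] gsI; first by exists 0%N.
have [|n nP] := IH; first by move=> h hgs; apply: gsI; rewrite inE hgs orbT.
have [m mP] := gen_range_stage (gsI g (mem_head _ _)).
exists (maxn m n) => h; rewrite inE => /predU1P[->|/nP].
  apply: gen_sub mP => _ [j ltj ->]; exists j => //.
  by rewrite (leq_trans ltj) ?leq_maxl.
apply: gen_sub => _ [j ltj ->]; exists j => //.
by rewrite (leq_trans ltj) ?leq_maxr.
Qed.

(* Hilbert's basis theorem: were the ideal [I] of the [p i] not finitely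
   generated, picking elements [q i] of minimal degree outside the ideal of the
   previous ones would give leading coefficients contradicting [noetherian S]. *)
Lemma noetherian_poly (S : comNzRingType) :
  noetherian S -> noetherian {poly S}.
Proof.
move=> noeS p; apply: noetherian_fg; apply: contrapT => notfg.
set I := gen (fun x => exists i, x = p i) in notfg *.
have next (gs : seq {poly S}) : exists q, (forall g, g \in gs -> I g) ->
    [/\ I q, ~ gen (fun x => x \in gs) q &
      forall r, I r -> ~ gen (fun x => x \in gs) r -> (size q <= size r)%N].
  have [gsI|] := pselect (forall g, g \in gs -> I g); last by exists 0.
  have ex_k : exists k, `[< exists r, [/\ I r,
      ~ gen (fun x => x \in gs) r & size r = k] >].
    apply: contrapT => nok; apply: notfg; exists gs => // i.
    apply: contrapT => npi; apply: nok; exists (size (p i)); apply/asboolP.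
    by exists (p i); split=> //; apply: gen_in; exists i.
  case: (ex_minnP ex_k) => k /asboolP[q [Iq nq szq]] kmin.
  exists q => _; split=> // r Ir nr; rewrite szq; apply: kmin.
  by apply/asboolP; exists r.
have [f fP] := choice next.
pose G := fix G n := if n is n'.+1 then rcons (G n') (f (G n')) else [::].
have GI n g : g \in G n -> I g.
  elim: n g => //= n IH g; rewrite mem_rcons inE => /predU1P[->|/IH //].
  by case: (fP _ IH).
pose q n := f (G n).
have memG n g : g \in G n <-> exists2 i, (i < n)%N & g = q i.
  elim: n g => [|n IH] g /=; first by split=> // -[].
  rewrite mem_rcons inE; split=> [/predU1P[->|/IH[i lti ->]]|].
  - by exists n.
  - by exists i => //; apply: ltnW.
  case=> i; rewrite ltnS leq_eqVlt => /predU1P[->|lti] ->.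
    by rewrite /q eqxx.
  by apply/orP; right; apply/IH; exists i.
have qP n := fP _ (GI n).
have [n gn] := noeS (fun n => lead_coef (q n)).
have [Iq nq qmin] := qP n.
have q0 i : q i != 0.
  by apply/eqP=> q0; case: (qP i) => _ + _; rewrite -/(q i) q0; case; apply: gen_zero.
have szq : (size (q n)).-1.+1 = size (q n).
  by rewrite prednK // size_poly_gt0.
have Gsz g : g \in G n -> g != 0 /\ (size g <= (size (q n)).-1.+1)%N.
  move=> /memG[i lti ->]; split=> //; rewrite szq.
  have [_ _ imin] := qP i; apply: imin => // gi; apply: nq.
  apply: gen_sub gi => g' /memG[j ltj ->]; apply/memG; exists j => //.
  exact: ltn_trans lti.
have gn' : gen (fun a => exists2 q, q \in G n & a = lead_coef q) (lead_coef (q n)).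
  apply: gen_sub gn => _ [i lti ->]; exists (q i) => //; apply/memG.
  by exists i.
have [r [gr szr rm]] := gen_lead_coef Gsz gn'.
have Ir : I r by apply: gen_trans gr => g /GI.
(* As [r] lies in the ideal of the earlier [q i], the difference is outside it too, yet its leading
   term cancels. *)
have nqr : ~ gen (fun x => x \in G n) (q n - r).
  by move=> gqr; apply: nq; rewrite -[f _](subrK r); apply: genD.
have := qmin _ (genB Iq Ir) nqr; apply/negP; rewrite -ltnNge -/(q n) -szq ltnS.
apply/leq_sizeP => j; rewrite leq_eqVlt => /predU1P[<-|ltj].
  by rewrite coefB rm lead_coefE subrr.
rewrite coefB !nth_default ?subrr //; first exact: leq_trans szr _.
by rewrite -szq.
Qed.

(** Otherwise every nonzero [x] has [a], [b] with [a * b * x = 0] and [a * x], [b * x] nonzero.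
    Passing repeatedly from [x] to [b * x], the earlier [a] kill the later [x], so no [a] lies in
    the ideal of its predecessors. *)
Lemma noetherian_prime_annihilator (S : comNzRingType) :
  noetherian S ->
  exists2 x : S, x != 0 & forall a b, a * b * x = 0 -> a * x = 0 \/ b * x = 0.
Proof.
move=> noeS; apply: contrapT => nox.
have next (x : S) : exists ab : S * S, x != 0 ->
    [/\ ab.1 * ab.2 * x = 0, ab.1 * x != 0 & ab.2 * x != 0].
  have [->|x0] := eqVneq x 0; first by exists (0, 0).
  apply: contrapT => noab; apply: nox; exists x => // a b abx.
  apply: contrapT => nab; apply: noab; exists (a, b) => _; split=> //=.
    by apply/eqP => ax; apply: nab; left.
  by apply/eqP => bx; apply: nab; right.
have [f fP] := choice next.
pose x n := iter n (fun x => (f x).2 * x) 1.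
have x0 n : x n != 0.
  by elim: n => [|n IH] /=; [apply: oner_neq0 | case: (fP _ IH)].
have [n gn] := noeS (fun n => (f (x n)).1).
have [_ /eqP + _] := fP _ (x0 n); apply.
have ann i j : (i < j)%N -> (f (x i)).1 * x j = 0.
  elim: j => // j IH; rewrite ltnS leq_eqVlt => /predU1P[->|/IH fx] /=.
    by have [+ _ _] := fP _ (x0 j); rewrite -mulrA.
  by rewrite mulrCA fx mulr0.
by rewrite mulrC; apply: gen_ann gn => _ [i lti ->]; rewrite mulrC ann.
Qed.

Definition generates (K T : comNzRingType) (iota : K -> T) (xs : seq T) : Prop :=
  forall B : T -> Prop,
    (forall a, B (iota a)) -> (forall x, x \in xs -> B x) ->
    (forall u v, B u -> B v -> B (u - v)) ->
    (forall u v, B u -> B v -> B (u * v)) -> forall y, B y.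

(** [T] is an image of an iterated polynomial ring over [K], with a variable for each element of
    [xs]. [Q] may depend on the map to [T], as [sparse_units] does. *)
Lemma generated_ring_ind (K T : comNzRingType) (iota : {rmorphism K -> T})
    (xs : seq T) (Q : forall S : comNzRingType, {rmorphism S -> T} -> Prop) :
  generates iota xs -> Q K iota ->
  (forall (S : comNzRingType) (f : {rmorphism S -> T})
      (g : {rmorphism {poly S} -> T}),
    Q S f -> (forall a, g a%:P = f a) ->
    (forall p, g p = (map_poly f p).[g 'X]) -> Q {poly S} g) ->
  exists (S : comNzRingType) (f : {rmorphism S -> T}),
    Q S f /\ forall y, exists s, f s = y.
Proof.
move=> genxs QK Qstep.
suff [S [f [QS fK fxs]]] : exists (S : comNzRingType) (f : {rmorphism S -> T}),
    [/\ Q S f, forall a, exists s, f s = iota a &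
        forall x, x \in xs -> exists s, f s = x].
  exists S, f; split=> //; apply: genxs => // u v [s <-] [r <-].
    by exists (s - r); rewrite rmorphB.
  by exists (s * r); rewrite rmorphM.
elim: xs {genxs} => [|x xs [S [f [QS fK fxs]]]].
  by exists K, iota; split=> // a; exists a.
have cfx : commr_rmorph f x by move=> a; apply: mulrC.
pose g : {rmorphism {poly S} -> T} := horner_morph cfx.
have gC a : g a%:P = f a by exact: horner_morphC.
exists {poly S}, g; split.
- by apply: Qstep QS _ _ => // p; rewrite /g /= horner_morphX.
- by move=> a; have [s <-] := fK a; exists s%:P.
- move=> z; rewrite inE => /predU1P[->|/fxs[s <-]].
    by exists 'X; apply: horner_morphX.
  by exists s%:P.
Qed.

Lemma noetherian_generated (K : fieldType) (T : comNzRingType)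
    (iota : {rmorphism K -> T}) (xs : seq T) :
  generates iota xs -> noetherian T.
Proof.
move=> genxs; have [||S [f [noeS fsurj]]] :=
    @generated_ring_ind _ _ iota xs (fun S _ => noetherian S) genxs.
- exact: noetherian_field.
- by move=> S _ _ noeS _ _; apply: noetherian_poly.
- exact: noetherian_image fsurj noeS.
Qed.

End Noetherian.

(** * Simple difference rings *)

Section IterMorphism.
Variables (S : nzRingType) (n : nat) (s : {rmorphism S -> S}).

Fact iter_is_zmod_morphism : zmod_morphism (iter n s).
Proof. by move=> x y; elim: n => //= m ->; rewrite rmorphB. Qed.

Fact iter_is_monoid_morphism : monoid_morphism (iter n s).
Proof.
split=> [|x y]; first by elim: n => //= m ->; rewrite rmorph1.
by elim: n => //= m ->; rewrite rmorphM.
Qed.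

HB.instance Definition _ :=
  GRing.isZmodMorphism.Build S S (iter n s) iter_is_zmod_morphism.
HB.instance Definition _ :=
  GRing.isMonoidMorphism.Build S S (iter n s) iter_is_monoid_morphism.

End IterMorphism.

Section IterPeriod.
Variables (T : Type) (f : T -> T).

Lemma iter_period (d : nat) (x : T) :
  iter d f x = x -> forall k, iter (k * d) f x = x.
Proof. by move=> fx; elim=> // k IH; rewrite mulSn iterD IH. Qed.

Lemma iter_comm (i j : nat) (x : T) : iter i f (iter j f x) = iter j f (iter i f x).
Proof. by rewrite -!iterD addnC. Qed.

End IterPeriod.

Section SimpleDifferenceRing.
Variables (S : comNzRingType) (s : {rmorphism S -> S}).
Hypotheses (s_bij : bijective s) (s_simple : sigma_simple s).

(** Excluded middle carries [sigma_simple] from boolean ideals omitting 1 over to ideals in [Prop],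
    as a device for producing 1. *)
Lemma sigma_simple_top (I : S -> Prop) (v : S) :
    (forall a u w, I u -> I w -> I (a * u + w)) ->
    (forall a, I a -> I (s a)) -> I v -> v != 0 -> I 1.
Proof.
move=> Iadd Is Iv v0; apply: contrapT => I1.
have [] := negP v0.
have I0 : I 0 by have := Iadd (-1) v v Iv Iv; rewrite mulN1r addNr.
have I_closed : idealr_closed (fun a => `[< I a >]).
  split=> [||a u w /asboolP Iu /asboolP Iw]; first exact/asboolP.
    by apply/negP => /asboolP.
  by apply/asboolP/Iadd.
have := s_simple I_closed; rewrite /eq_mem => /(_ _ v).
rewrite [v \in pred1 0]inE => <-; first exact/asboolP.
by move=> a /asboolP Ia; apply/asboolP/Is.
Qed.

Lemma iter_sigma_bij i : bijective (iter i s).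
Proof.
elim: i => [|i IH]; first by exists id.
exact: (bij_comp s_bij IH).
Qed.

Lemma iter_sigma_eq0 i x : (iter i s x == 0) = (x == 0).
Proof.
apply/eqP/eqP => [|->]; last by rewrite rmorph0.
by rewrite -[RHS in _ = RHS -> _](rmorph0 (iter i s)) => /(bij_inj (iter_sigma_bij i)).
Qed.

(* The annihilators [P_i] of the [s^i x], [i < N], intersect in 0 as the [s^i x]
   generate the unit ideal; the prime [P_N] thus contains some [P_i], and all
   these primes are minimal. *)
Lemma cyclic_prime : noetherian S ->
  exists (x e : S) (l : nat),
    [/\ x != 0 /\ (0 < l)%N,
        forall a b, a * b * x = 0 -> a * x = 0 \/ b * x = 0,
        forall a, iter l s a * x = 0 <-> a * x = 0,
        (1 - e) * x = 0 &
        forall k, (0 < k < l)%N -> iter k s e * x = 0].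
Proof.
move=> noeS; have [x x0 x_prime] := noetherian_prime_annihilator noeS.
pose X i := iter i s x.
have X_prime i a b : a * b * X i = 0 -> a * X i = 0 \/ b * X i = 0.
  have [g _ gK] := iter_sigma_bij i.
  rewrite -[a]gK -[b]gK -!rmorphM => /eqP; rewrite iter_sigma_eq0 => /eqP.
  by case/x_prime => eq0; [left | right]; rewrite eq0 rmorph0.
have shift i j a : iter i s a * X (i + j)%N = 0 <-> a * X j = 0.
  rewrite /X iterD -rmorphM; split=> [/eqP|->]; last by rewrite rmorph0.
  by rewrite iter_sigma_eq0 => /eqP.
have shift0 i a : iter i s a * X i = 0 <-> a * x = 0.
  by have := shift i 0%N a; rewrite addn0.
have X0 i : X i <> 0 by move/eqP; rewrite iter_sigma_eq0 (negPf x0).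
have gen1 : gen (fun y => exists i, y = X i) 1.
  apply: (@sigma_simple_top _ x) x0; last by apply: gen_in; exists 0%N.
    by move=> a u v gu gv; apply: genD => //; apply: genM.
  move=> a /(gen_map s); apply: gen_sub => _ [_ [i ->] ->].
  by exists i.+1.
have kill a : (forall i, a * X i = 0) -> a = 0.
  by move=> aX; rewrite -[a]mulr1; apply: gen_ann gen1 => _ [i ->].
(* Otherwise, by primality, [x] would kill every [X i] and hence 1. *)
have xx0 : x * x <> 0.
  move=> xx; have := kill x; move=> xX; apply: (X0 0%N); apply: xX => i.
  by have [||] := @X_prime i x x; rewrite ?xx ?mul0r.
have XX0 i : X i * X i <> 0.
  by move=> XX; apply/xx0/(shift0 i).
have [N genN] := gen_range_stage gen1.
(* By [xk] and [XX0], [X k] is not in the annihilator of [x]; so the prime property turns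
   [b * X k * x = 0] into [b * x = 0]. *)
have ann_incl k : (forall b, b * x = 0 -> b * X k = 0) ->
    forall b, b * X k = 0 -> b * x = 0.
  move=> xk b bk; have [||] // := x_prime b (X k); first by rewrite bk mul0r.
  by move=> /xk /XX0.
have [l0 l0P] : exists k, (0 < k)%N /\ forall b, b * x = 0 -> b * X k = 0.
  suff [i ltiN iN] : exists2 i, (i < N)%N & forall b, b * X i = 0 -> b * X N = 0.
    exists (N - i)%N; split=> [|b bx]; first by rewrite subn_gt0.
    apply/(shift i); rewrite subnKC 1?ltnW //; apply: iN.
    exact/shift0.
  apply: contrapT => noi.
  (* Each [f i] lies in [P_i] but not in [P_N]. Their product kills generators of the unit ideal, so
     it is 0, yet it avoids the prime [P_N]. *)
  have exa i : exists a, (i < N)%N -> a * X i = 0 /\ a * X N <> 0.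
    apply: contrapT => noa; apply: noi; exists i => [|b bi].
      by apply: contrapT => ltiN; apply: noa; exists 0.
    by apply: contrapT => bN; apply: noa; exists b.
  have [f fP] := choice exa.
  have prodXN n : (n <= N)%N -> (\prod_(i < n) f i) * X N <> 0.
    elim: n => [|n IH] lenN; first by rewrite big_ord0 mul1r; apply: X0.
    rewrite big_ord_recr /= => /X_prime[/IH|]; first by apply; apply: ltnW.
    by case: (fP n lenN).
  apply: (prodXN N (leqnn N)); rewrite (_ : \prod_(i < N) f i = 0) ?mul0r //.
  rewrite -[LHS]mulr1; apply: gen_ann genN => _ [i ltiN ->].
  rewrite (bigD1 (Ordinal ltiN)) //= mulrAC.
  by case: (fP i ltiN) => -> _; rewrite mul0r.
have ex_l : exists k, (0 < k)%N && `[< forall b, b * x = 0 -> b * X k = 0 >].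
  by exists l0; case: l0P => -> ?; apply/asboolP.
case: (ex_minnP ex_l) => l /andP[l_gt0 /asboolP xl] lmin.
have X_l a i : a * X (i + l)%N = 0 <-> a * X i = 0.
  have [g _ gK] := iter_sigma_bij i; rewrite -[a]gK shift shift0; split; last exact: xl.
  exact: ann_incl.
have X_ml a m i : a * X (i + m * l)%N = 0 <-> a * X i = 0.
  by elim: m => [|m IH]; rewrite ?addn0 // mulSn [(l + _)%N]addnC addnA X_l.
(* If [x] were outside [P_r], the annihilator of [x] would lie in the prime [P_r] with [0 < r < l],
   against minimality. *)
have xX i : ~~ (l %| i)%N -> x * X i = 0.
  move=> nli; rewrite (divn_eq i l) addnC; apply/X_ml.
  set r := (i %% l)%N; have r_gt0 : (0 < r)%N by rewrite lt0n.
  apply: contrapT => xr; suff : (l <= r)%N by rewrite leqNgt ltn_mod l_gt0.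
  apply: lmin; rewrite r_gt0; apply/asboolP => b bx.
  by have [||] // := @X_prime r b x; rewrite bx mul0r.
(* The terms of an expression of 1 are sorted by whether [l] divides their index; [xX] then yields
   both claims on [e]. *)
have [e [f [ge gf ef]]] : exists e f,
   [/\ gen (fun y => exists2 i, (l %| i)%N & y = X i) e,
       gen (fun y => exists2 i, ~~ (l %| i)%N & y = X i) f & 1 = e + f].
  elim: gen1 => [|c _ z [i ->] _ [e [f [ge gf ->]]]].
    by exists 0, 0; rewrite addr0; split=> //; apply: gen_zero.
  have [li|nli] := boolP (l %| i)%N.
    by exists (c * X i + e), f; rewrite addrA; split=> //; apply: gen_step => //;
      exists i.
  by exists e, (c * X i + f); rewrite addrCA; split=> //; apply: gen_step => //;
    exists i.
exists x, e, l; split=> //.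
- by move=> a; rewrite -(X_l _ 0%N) add0n shift0.
- rewrite ef addrAC subrr add0r.
  by rewrite mulrC; apply: gen_ann gf => _ [i nli ->]; apply: xX.
- move=> k /andP[k_gt0 ltkl].
  elim: ge => [|c _ z [i li ->] _ IH]; first by rewrite rmorph0 mul0r.
  rewrite rmorphD mulrDl IH addr0 rmorphM -mulrA /= /X -iterD [_ * x]mulrC.
  by rewrite -/(X _) xX ?mulr0 // dvdn_addl // gtnNdvd.
Qed.

End SimpleDifferenceRing.

(** * Residue fields and idempotents *)

Section ResidueField.
Variables (S : comNzRingType) (P : S -> Prop).
Hypotheses (P0 : P 0) (P1 : ~ P 1).
Hypothesis PD : forall a u v, P u -> P v -> P (a * u + v).
Hypothesis PM : forall u v, P (u * v) -> P u \/ P v.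

Let I : {pred S} := fun a => `[< P a >].

Let I_idealr : idealr_closed I.
Proof.
split=> [||a u v /asboolP Pu /asboolP Pv]; first exact/asboolP.
  by apply/negP => /asboolP.
by apply/asboolP/PD.
Qed.

Let I_prime : prime_idealr_closed I.
Proof.
by move=> u v /asboolP/PM[] Px; apply/orP; [left | right]; apply/asboolP.
Qed.

HB.instance Definition _ := isIdealr.Build S I I_idealr.
HB.instance Definition _ := isPrimeIdealrClosed.Build S I I_prime.

Let Q := {ideal_quot I}.
HB.instance Definition _ := GRing.ComNzRing.on Q.

(** The domain structure on the quotient includes an inverse function; choice supplies it, with the
    identity on nonunits. *)
Let Q_ex_inv (x : Q) : exists y : Q, (exists z, z * x = 1) -> y * x = 1.
Proof. by have [[z zx]|nz] := pselect (exists z, z * x = 1); [exists z | exists x]. Qed.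

Let Q_unit : pred Q := fun x => `[< exists z, z * x = 1 >].
Let Q_inv (x : Q) : Q := if Q_unit x then projT1 (cid (Q_ex_inv x)) else x.

Let Q_mulVr : {in Q_unit, left_inverse 1 Q_inv *%R}.
Proof.
move=> x xU; rewrite /Q_inv (xU : Q_unit x).
by case: cid => y /= yx; apply: yx; apply/asboolP.
Qed.

Let Q_unitP (x y : Q) : y * x = 1 -> x \in Q_unit.
Proof. by move=> yx; apply/asboolP; exists y. Qed.

Let Q_inv_out : {in [predC Q_unit], Q_inv =1 id}.
Proof. by move=> x; rewrite /Q_inv => /negPf xU; rewrite (xU : Q_unit x = false). Qed.

HB.instance Definition _ :=
  GRing.ComNzRing_hasMulInverse.Build Q Q_mulVr Q_unitP Q_inv_out.
HB.instance Definition _ :=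
  GRing.ComUnitRing_isIntegral.Build Q (@Quotient.rquot_IdomainAxiom _ I).

Lemma residue_field :
  exists (F : fieldType) (f : {rmorphism S -> F}), forall a, f a = 0 <-> P a.
Proof.
pose g : {rmorphism S -> Q} := \pi_({ideal_quot I})%qT.
exists {fraction Q}, (@FracField.tofrac Q \o g) => a /=.
split=> [/eqP|Pa].
  rewrite tofrac_eq0 -(rmorph0 g) /g /= -Quotient.idealrBE subr0.
  by move/asboolP.
apply/eqP; rewrite tofrac_eq0 -(rmorph0 g) /g /= -Quotient.idealrBE subr0.
exact/asboolP.
Qed.

End ResidueField.


Lemma dvdn_add_complement (l k : nat) :
  (0 < l)%N -> exists2 i, (i < l)%N & (l %| k + i)%N.
Proof.
move=> l_gt0; exists ((l - k %% l) %% l)%N; first by rewrite ltn_mod.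
by rewrite /dvdn modnDmr -modnDml subnKC ?modnn // ltnW // ltn_mod.
Qed.

Section CyclicComponents.
Variables (S : comNzRingType) (s : {rmorphism S -> S}).
Hypotheses (s_simple : sigma_simple s).
Variables (F : fieldType) (f : {rmorphism S -> F}) (l : nat) (e : S).
Hypotheses (l_gt0 : (0 < l)%N) (f_l : forall a, f (iter l s a) = 0 <-> f a = 0).
Hypotheses (f_e : f e = 1) (f_ie : forall k, (0 < k < l)%N -> f (iter k s e) = 0).

Lemma residue_iter_mul m a : f (iter (m * l) s a) = 0 <-> f a = 0.
Proof. by elim: m => //= m IH; rewrite mulSn iterD f_l. Qed.

Lemma residue_iter_modn k a :
  f (iter k s a) = 0 <-> f (iter (k %% l) s a) = 0.
Proof. by rewrite {1}(divn_eq k l) iterD residue_iter_mul. Qed.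

(** The kernel of [f] is stable under [s^l], so it keeps [1 - e] along multiples of [l]. The
    residues of the conjugates of [e] thus form an indicator sequence before [e] is known to be
    idempotent. *)
Lemma residue_idem k : f (iter k s e) = (l %| k)%N%:R.
Proof.
have [/dvdnP[m ->]|nlk] := boolP (l %| k)%N.
  apply/esym/eqP; rewrite -subr_eq0 -[in X in X - _](rmorph1 f).
  rewrite -[in X in f X](rmorph1 (iter (m * l) s)) -!rmorphB; apply/eqP.
  by apply/residue_iter_mul; rewrite rmorphB rmorph1 f_e subrr.
by apply/residue_iter_modn/f_ie; rewrite lt0n nlk ltn_mod.
Qed.

(** Such elements form an [s]-stable ideal without 1. Identities in [S] can therefore be checked on
    the sequences [i |-> f (s^i a)]. *)
Lemma residue_eq0 a : (forall i, f (iter i s a) = 0) -> a = 0.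
Proof.
move=> fa; apply: contrapT => /eqP a0.
suff : f 1 = 0 by apply/eqP; rewrite rmorph1 oner_eq0.
pose I x := forall i, f (iter i s x) = 0.
apply: (@sigma_simple_top _ _ s_simple I a _ _ fa a0 0%N) => [b u v Iu Iv i|u Iu i].
  by rewrite rmorphD rmorphM /= rmorphD rmorphM /= Iu Iv mulr0 addr0.
by rewrite -iterSr; apply: Iu.
Qed.

Lemma residue_idem_cases (g : S) k :
  g * g = g -> f (iter k s g) = 0 \/ f (iter k s g) = 1.
Proof.
move=> gg; have : f (iter k s g) * (f (iter k s g) - 1) = 0.
  by rewrite mulrBr mulr1 -rmorphM -rmorphM gg subrr.
by move/eqP; rewrite mulf_eq0 subr_eq0 => /orP[] /eqP; [left | right].
Qed.

Lemma residue_idem_iter k i :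
  f (iter k s (iter i s e)) = (l %| k + i)%N%:R.
Proof. by rewrite -iterD residue_idem. Qed.

Lemma iter_idem_neq0 i : (i < l)%N -> iter i s e != 0.
Proof.
move=> ltil; apply/eqP => ei; have := residue_idem_iter (l - i)%N i.
rewrite ei !rmorph0 subnK ?dvdnn 1?ltnW // => /esym/eqP.
by rewrite oner_eq0.
Qed.

(** The residues of [s^i e] are the indicator of one class modulo [l]. Off this class those of [g]
    and [h] are opposite with product 0, so both vanish; on it one vanishes at some index, hence at
    all. *)
Lemma iter_idem_primitive i : (i < l)%N -> primitive_idempotent (iter i s e).
Proof.
move=> ltil; split=> [||g h gg hh gh egh]; first exact: iter_idem_neq0.
  by rewrite -rmorphM; congr (iter i s _); apply/eqP; rewrite -subr_eq0;
    apply/eqP/residue_eq0 => k; rewrite rmorphB rmorphM rmorphB rmorphM /=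
    residue_idem; case: (_ %| _)%N; rewrite ?mulr1 ?mulr0 subrr.
have fgh k : f (iter k s g) * f (iter k s h) = 0.
  by rewrite -!rmorphM gh !rmorph0.
have out k : ~~ (l %| k + i)%N -> f (iter k s g) = 0 /\ f (iter k s h) = 0.
  move=> /negPf nki; have := residue_idem_iter k i.
  rewrite nki egh !rmorphD /= => /eqP; rewrite addr_eq0 => /eqP fg.
  move: (fgh k); rewrite fg mulNr => /eqP.
  by rewrite oppr_eq0 mulf_eq0 orbb => /eqP ->; rewrite oppr0.
have same k k' x : (l %| k + i)%N -> (l %| k' + i)%N ->
    f (iter k s x) = 0 -> f (iter k' s x) = 0.
  move=> lk lk' /residue_iter_modn fx; apply/residue_iter_modn.
  suff /eqP <- : k == k' %[mod l] by [].
  by rewrite -(eqn_modDr i); move: lk lk'; rewrite /dvdn => /eqP -> /eqP ->.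
have lki : (l %| (l - i) + i)%N by rewrite subnK ?dvdnn // ltnW.
have /eqP := fgh (l - i)%N; rewrite mulf_eq0 => /orP[] /eqP fx; [left | right];
  by apply: residue_eq0 => k; have [lk|/out[]//] := boolP (l %| k + i)%N;
    apply: same fx.
Qed.

(** A nonzero residue of a conjugate of [g] selects [ei]. Primitivity applied to
    [g = g * ei + g * (1 - ei)] gives [g = g * ei], and as residues of idempotents are 0 or 1, [g]
    and [ei] have the same sequence. *)
Lemma primitive_idempotent_iter (g : S) :
  primitive_idempotent g -> exists2 i, (i < l)%N & g = iter i s e.
Proof.
case=> g0 gg gprim.
have [k fk] : exists k, f (iter k s g) <> 0.
  apply: contrapT => nok; case/eqP: g0; apply: residue_eq0 => k.
  by apply: contrapT => fk; apply: nok; exists k.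
have [i ltil lki] := dvdn_add_complement k l_gt0; exists i => //.
set ei := iter i s e; have [_ eiei _] := iter_idem_primitive ltil.
rewrite -/ei in eiei.
have e1 : g * ei * (g * ei) = g * ei by rewrite mulrACA gg eiei.
have e2 : g * (1 - ei) * (g * (1 - ei)) = g * (1 - ei).
  by rewrite mulrACA gg mulrBr mulr1 mulrBl mul1r eiei subrr subr0.
have e3 : g * ei * (g * (1 - ei)) = 0.
  by rewrite mulrACA mulrBr mulr1 eiei subrr mulr0.
have [|gei|gei] := gprim _ _ e1 e2 e3; first by rewrite -mulrDr addrC subrK mulr1.
  have := residue_idem_iter k i; rewrite lki => fei; case: fk.
  by rewrite -[LHS]mulr1 -[1]/(true%:R) -fei -!rmorphM gei !rmorph0.
have ge : g = g * ei by apply/eqP; rewrite -subr_eq0 -{1}[g]mulr1 -mulrBr gei.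
apply/eqP; rewrite -subr_eq0; apply/eqP/residue_eq0 => k'.
have [lk'|nlk'] := boolP (l %| k' + i)%N; last first.
  by rewrite ge !rmorphB !rmorphM /= residue_idem_iter (negPf nlk') mulr0 subrr.
rewrite !rmorphB /= residue_idem_iter lk'.
have [fg0|->] := residue_idem_cases k' gg; last by rewrite subrr.
case: fk; apply/residue_iter_modn; suff /eqP -> : k == k' %[mod l].
  by rewrite -residue_iter_modn.
by rewrite -(eqn_modDr i); move: lki lk'; rewrite /dvdn => /eqP -> /eqP ->.
Qed.

Lemma card_primitive_idempotents : has_card (@primitive_idempotent S) l.
Proof.
exists (mkseq (fun i => iter i s e) l); split; last 1 first.
- move=> g; split=> [/mapP[i]|/primitive_idempotent_iter[i ltil ->]].
    by rewrite mem_iota => /andP[_ ltil] ->; apply: iter_idem_primitive.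
  by apply/mapP; exists i => //; rewrite mem_iota.
- apply/mkseq_uniqP => i j; rewrite !inE => ltil ltjl eij.
  have := residue_idem_iter (l - i)%N j; rewrite -eij residue_idem_iter.
  rewrite [(_ + i)%N]subnK ?dvdnn 1?ltnW // => /eqP.
  case: (boolP (_ %| _)%N) => [|_]; last by rewrite oner_eq0.
  move=> /eqP lij _; have : (l - i + i == l - i + j %[mod l])%N.
    by rewrite lij subnK ?modnn // ltnW.
  by rewrite eqn_modDl !modn_small // => /eqP.
- by rewrite size_mkseq.
Qed.

(* Although [I] is stable under [iter m s] only, it contains an element which
   is nonzero in every component, and the product of its conjugates lies in the
   largest [s]-stable ideal inside [I]. *)
Lemma residue_simple (m : nat) (I : S -> Prop) (v : S) :
    (0 < m)%N -> (l %| m)%N ->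
    (forall a u w, I u -> I w -> I (a * u + w)) ->
    (forall a, I a -> I (iter m s a)) ->
    (forall a, f a = 0 -> I a) ->
    I v -> f v != 0 -> I 1.
Proof.
move=> m_gt0 lm Iadd Im If Iv fv.
have I0 : I 0 by apply: If; rewrite rmorph0.
have IM a u : I u -> I (a * u) by move=> Iu; rewrite -[_ * _]addr0; apply: Iadd.
have Itm t a : I a -> I (iter (t * m) s a).
  by move=> Ia; elim: t => //= t IH; rewrite mulSn iterD; apply: Im.
pose w := e * v + (1 - e).
have Iw : I w by apply: Iadd => //; apply: If; rewrite rmorphB rmorph1 f_e subrr.
have fw k : f (iter k s w) != 0.
  have -> : f (iter k s w) = f (iter k s e) * f (iter k s v) + (1 - f (iter k s e)).
    by rewrite /w rmorphD rmorphM rmorphB rmorph1 rmorphD rmorphM rmorphB rmorph1.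
  rewrite residue_idem; have [/dvdnP[t ->]|_] := boolP (l %| k)%N.
    rewrite mul1r subrr addr0; apply: contraNneq fv => fv.
    exact/eqP/residue_iter_mul/fv.
  by rewrite mul0r add0r subr0 oner_eq0.
pose x := \prod_(j < m) iter j s w.
pose H a := forall i, I (iter i s a).
(* Among the [m] indices [i + j] one is divisible by [m], and [I] is stable under [s^m]. *)
have Hx : H x.
  move=> i; have [j ltjm /dvdnP[t ij]] := dvdn_add_complement i m_gt0.
  rewrite rmorph_prod (bigD1 (Ordinal ltjm)) //= mulrC -iterD ij.
  by apply/IM/Itm.
have fx : f x != 0 by rewrite rmorph_prod; apply/prodf_neq0 => j _; apply: fw.
have x0 : x != 0 by apply: contraNneq fx => ->; rewrite rmorph0.
apply: (@sigma_simple_top _ _ s_simple H x _ _ Hx x0 0%N) => [a u y Hu Hy i|u Hu i].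
  by rewrite rmorphD rmorphM; apply: Iadd; [apply: Hu | apply: Hy].
by rewrite -iterSr; apply: Hu.
Qed.

End CyclicComponents.

(** * Units in finitely generated rings *)

Section IntegralDenominators.
Variables (D : comNzRingType) (F : fieldType) (delta : {rmorphism D -> F}).
Local Notation integral := (integralOver delta).

Lemma integral_exp u k : integral u -> integral (u ^+ k).
Proof.
move=> iu; elim: k => [|k IH]; first exact: integral1.
by rewrite exprS; apply: integral_mul.
Qed.

(** If [P] has degree [k + 1] and leading coefficient [d], then [d^k P(x)] is a monic polynomial in
    [d x]. *)
Lemma integral_lead_mul (p : {poly D}) (x : F) :
    map_poly delta p != 0 -> root (map_poly delta p) x ->
  exists2 d, delta d != 0 & integral (delta d * x).
Proof.
set P := map_poly delta p => P0 /rootP Px.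
have [k szP] : exists k, size P = k.+2.
  case: (size P) (size_poly_gt0 P) (size1_polyC (p := P)) => [|[|k]] szP sz1.
  - by rewrite P0 in szP.
  - have Pc := sz1 isT; move: Px P0; rewrite Pc hornerC polyC_eq0.
    by move=> ->; rewrite eqxx.
  - by exists k.
have d0 : P`_k.+1 != 0.
  by rewrite -[k.+1]/(k.+2.-1) -szP -lead_coefE lead_coef_eq0.
exists p`_k.+1; rewrite -coef_map -/P //.
set d := P`_k.+1 in d0 *.
pose q : {poly F} := 'X^(k.+1) + \poly_(i < k.+1) (P`_i * d ^+ (k - i)).
apply: (@integral_root_monic _ _ _ _ q).
- rewrite monicE lead_coefDl ?lead_coefXn // size_polyXn ltnS.
  exact: size_poly.
- apply/rootP; rewrite /q hornerD hornerXn horner_poly.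
  have : d ^+ k * P.[x] = 0 by rewrite Px mulr0.
  rewrite horner_coef szP big_ord_recr /= -/d mulrDr mulr_sumr => eq0.
  rewrite -[RHS]eq0 addrC; congr (_ + _); last by rewrite exprMn exprSr; ring.
  apply: eq_bigr => i _; rewrite exprMn.
  have -> : d ^+ k = d ^+ (k - i) * d ^+ i by rewrite -exprD subnK // leq_ord.
  by ring.
- move=> a /(nthP 0)[i _ <-]; rewrite coefD coefXn coef_poly.
  apply: integral_add; first exact: integral_nat.
  case: ifP => _; last exact: integral0.
  by rewrite /d !coef_map -rmorphXn -rmorphM; apply: integral_id.
Qed.

(** Dividing the equation of [z] by a power of [z] makes its lowest nonzero coefficient the constant
    term; over [z], this coefficient is minus a polynomial in [z]. *)
Lemma integral_inv_denominator (z : F) :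
  integral z -> z != 0 -> exists2 d, delta d != 0 & integral (delta d / z).
Proof.
case=> r mon_r /rootP rz z0; set P := map_poly delta r in rz.
have P0 : P != 0 by rewrite monic_neq0 ?monic_map.
have ex_i : exists i, P`_i != 0.
  by exists (size P).-1; rewrite -lead_coefE lead_coef_eq0.
case: (ex_minnP ex_i) => i Pi imin.
exists r`_i; rewrite -coef_map -/P //.
have eP : P = ((P`_i)%:P + drop_poly i.+1 P * 'X) * 'X^i.
  apply/polyP => j; rewrite coefMXn; case: ltnP => [ltji|leij].
    by apply/eqP; apply: contraTT ltji => /imin; rewrite -leqNgt.
  rewrite coefD coefC coefMX coef_drop_poly.
  case: eqP => [/eqP|/eqP]; first by rewrite subn_eq0 => leji;
    rewrite addr0 (@anti_leq i j) // leij.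
  rewrite subn_eq0 -ltnNge => ltij.
  by rewrite add0r -subnS subnK.
have Pz : (drop_poly i.+1 P).[z] * z = - P`_i.
  move/eqP: (rz); rewrite {1}eP !(hornerM, hornerD, hornerC, hornerX, hornerXn).
  by rewrite mulf_eq0 expf_eq0 (negPf z0) andbF orbF addrC addr_eq0 => /eqP.
rewrite -[P`_i]opprK -Pz mulNr mulfK //; apply: integral_opp.
apply: integral_horner; last by exists r => //; apply/rootP.
move=> a /(nthP 0)[j _ <-]; rewrite coef_drop_poly coef_map.
exact: integral_id.
Qed.

(* Multiplying an equation [w^k = sum_(i < k) alpha_i w^i] by [b^(k-1)]. *)
Lemma integral_div_denominator (b d : D) (w : F) :
    integral w -> delta b * w = delta d ->
  exists (h : D) (k : nat), delta b * delta h = delta d ^+ k.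
Proof.
case=> r mon_r /rootP; set P := map_poly delta r => rw bw.
have lP : lead_coef P = 1 by apply/eqP; rewrite -monicE monic_map.
have szP : (size P).-1.+1 = size P.
  by rewrite prednK // size_poly_gt0 -lead_coef_eq0 lP oner_eq0.
move: rw; rewrite horner_coef -szP big_ord_recr /= -lead_coefE lP mul1r.
set k := (size P).-1 => /eqP; rewrite addrC addr_eq0 => /eqP wk.
exists (- \sum_(i < k) r`_i * d ^+ i * b ^+ (k - i.+1)), k.
rewrite rmorphN mulrN -bw exprMn wk mulrN; congr (- _).
rewrite rmorph_sum mulr_sumr mulr_sumr; apply: eq_bigr => i _.
rewrite coef_map !rmorphM !rmorphXn /= -bw exprMn.
have -> : delta b ^+ k = delta b ^+ (k - i.+1) * (delta b * delta b ^+ i).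
  by rewrite -exprS -exprD subnK.
by ring.
Qed.

End IntegralDenominators.


Section NonUnits.
Variables (K F : fieldType) (rho : {rmorphism K -> F}) (c : F).

(* The numbers [c - a] are not units in the localization of the image of [delta]
   at [g], apart from finitely many [a] (the roots of a polynomial [G]). *)
Definition sparse_units (D : comNzRingType) (delta : {rmorphism D -> F}) :=
  [/\ exists b, delta b = c, forall a, exists b, delta b = rho a &
      forall g, delta g != 0 -> exists2 G : {poly K}, G != 0 &
        forall a k h, (c - rho a) * delta h = delta g ^+ k -> root G a].

(** Setting ['X] to [a] in [('X - a) * h = g ^+ k] shows that [G = g] works. *)
Lemma sparse_units_base (delta : {rmorphism {poly K} -> F}) :
    (forall a, delta a%:P = rho a) -> delta 'X = c ->
    (forall p, delta p = 0 -> p = 0) ->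
  sparse_units delta.
Proof.
move=> deltaC deltaX inj; split=> [|a|g g0]; first by exists 'X.
  by exists a%:P.
exists g => [|a k h eq]; first by apply: contraNneq g0 => ->; rewrite rmorph0.
have /(congr1 (fun p => p.[a])) : ('X - a%:P) * h = g ^+ k.
  apply/eqP; rewrite -subr_eq0; apply/eqP/inj.
  by rewrite rmorphB rmorphM rmorphB /= deltaX deltaC eq rmorphXn subrr.
rewrite hornerM hornerXsubC subrr mul0r horner_exp => /esym/eqP.
by rewrite expf_eq0 => /andP[].
Qed.

Section Step.
Variables (D : comNzRingType) (delta : {rmorphism D -> F}).
Variable gam : {rmorphism {poly D} -> F}.
Hypotheses (gamC : forall a, gam a%:P = delta a).
Hypothesis gamE : forall p, gam p = (map_poly delta p).[gam 'X].
Hypothesis Hdelta : sparse_units delta.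

(** The equation holds between polynomials and passes to leading coefficients. These are taken after
    [delta], which may kill the leading coefficient of [g] itself. *)
Let transcendental_step :
    (forall p, gam p = 0 -> map_poly delta p = 0) ->
  forall g, gam g != 0 -> exists2 G : {poly K}, G != 0 &
    forall a k h, (c - rho a) * gam h = gam g ^+ k -> root G a.
Proof.
move=> inj g g0; have [[c0 c0E] rhoE dP] := Hdelta.
have Pg0 : map_poly delta g != 0.
  by apply: contraNneq g0; rewrite gamE => ->; rewrite horner0.
have [|G G0 GP] := dP g`_(size (map_poly delta g)).-1.
  by rewrite -coef_map -lead_coefE lead_coef_eq0.
exists G => // a k h eq; have [b bE] := rhoE a.
apply: (GP a k h`_(size (map_poly delta h)).-1).
rewrite -!coef_map -!lead_coefE -lead_coef_exp -lead_coefZ; congr lead_coef.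
apply/eqP; rewrite -subr_eq0 -rmorphXn -c0E -bE -rmorphB -map_polyZ -rmorphB.
apply/eqP/inj; rewrite -mul_polyC rmorphB rmorphM gamC !rmorphB /= c0E bE.
by rewrite eq rmorphXn subrr.
Qed.

(** Powers of [d1] make the values of [gam] integral, and [d2] does the same for [1 / gam g]. The
    equation then descends to [D], with [d1 * d2] in place of [g]. *)
Let algebraic_step p :
    gam p = 0 -> map_poly delta p != 0 ->
  forall g, gam g != 0 -> exists2 G : {poly K}, G != 0 &
    forall a k h, (c - rho a) * gam h = gam g ^+ k -> root G a.
Proof.
move=> p_x p0 g g0; have [[c0 c0E] rhoE dP] := Hdelta.
have [|d1 d10 d1x] := integral_lead_mul p0 (x := gam 'X).
  by apply/rootP; rewrite -gamE.
have denom h : exists m, integralOver delta (delta d1 ^+ m * gam h).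
  elim/poly_ind: h => [|h b [m IH]].
    by exists 0%N; rewrite rmorph0 mulr0; apply: integral0.
  exists m.+1; have -> : delta d1 ^+ m.+1 * gam (h * 'X + b%:P) =
      (delta d1 ^+ m * gam h) * (delta d1 * gam 'X) + delta (d1 ^+ m.+1 * b).
    rewrite rmorphD [gam (h * _)]rmorphM gamC [delta (_ * b)]rmorphM rmorphXn.
    rewrite mulrDr exprSr; congr (_ + _).
    by rewrite -!mulrA; congr (_ * _); rewrite mulrCA.
  by apply: integral_add; [apply: integral_mul | apply: integral_id].
have [m gm] := denom g.
have z0 : delta d1 ^+ m * gam g != 0 by rewrite mulf_neq0 // expf_neq0.
have [d2 d20 d2z] := integral_inv_denominator gm z0.
have [|G G0 GP] := dP (d1 * d2); first by rewrite rmorphM mulf_neq0.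
exists G => // a k h eq.
have [m' hm] := denom h.
have [b bE] := rhoE a.
have d2g : integralOver delta (delta d2 / gam g).
  rewrite (_ : _ / _ = delta d1 ^+ m * (delta d2 / (delta d1 ^+ m * gam g))).
    by apply: integral_mul => //; rewrite -rmorphXn; apply: integral_id.
  by field; rewrite ?g0 ?expf_neq0.
(* In the exponent, [m'] serves [gam h] and [k] serves the [k] factors [1 / gam g]. *)
pose w := delta (d1 * d2) ^+ (m' + k) * (gam h / gam g ^+ k).
have iw : integralOver delta w.
  have -> : w = (delta d1 ^+ k * delta d2 ^+ m') * (delta d1 ^+ m' * gam h) *
      (delta d2 / gam g) ^+ k.
    rewrite /w rmorphM !exprMn !exprD exprVn; field.
    by rewrite expf_neq0.
  apply: integral_mul; last exact: integral_exp.
  by apply: integral_mul => //; rewrite -!rmorphXn -rmorphM; apply: integral_id.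
have bw : delta (c0 - b) * w = delta ((d1 * d2) ^+ (m' + k)).
  rewrite rmorphB c0E bE /w rmorphXn mulrCA [_ * (_ / _)]mulrA eq divff ?mulr1 //.
  by rewrite expf_neq0.
have [h' [j h'E]] := integral_div_denominator iw bw.
apply: (GP a ((m' + k) * j)%N h').
by rewrite -c0E -bE -rmorphB h'E rmorphXn exprM.
Qed.

Lemma sparse_units_step : sparse_units gam.
Proof.
have [[b bc] rhoE dP] := Hdelta; split.
- by exists b%:P; rewrite gamC.
- by move=> a; have [b' <-] := rhoE a; exists b'%:P.
have [inj|ninj] := pselect (forall p, gam p = 0 -> map_poly delta p = 0).
  exact: transcendental_step.
apply: contrapT => nP; apply: ninj => p px; apply: contrapT => /eqP p0.
by apply: nP; apply: (algebraic_step px).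
Qed.

End Step.

(** The induction starts from the polynomial ring in [t], whose residue [c] is transcendental; a
    unit is the case [g = 1]. *)
Lemma units_generated (T : comNzRingType) (iota : {rmorphism K -> T})
    (f : {rmorphism T -> F}) (xs : seq T) (t : T) :
    generates iota xs -> (forall a, f (iota a) = rho a) -> f t = c ->
    (forall p : {poly K}, (map_poly rho p).[c] = 0 -> p = 0) ->
  exists2 G : {poly K}, G != 0 & forall a u, (c - rho a) * f u = 1 -> root G a.
Proof.
move=> genxs f_iota ft inj.
have ct : commr_rmorph iota t by move=> a; apply: mulrC.
pose ev : {rmorphism {poly K} -> T} := horner_morph ct.
have genev : generates ev xs.
  move=> B Bev; apply: genxs => a; have := Bev a%:P.
  by rewrite /ev /= horner_morphC.
have [||S [g [[_ _ units] gsurj]]] := @generated_ring_ind _ _ ev xs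
    (fun S g => sparse_units (f \o g)) genev.
- apply: sparse_units_base => [a||p].
  + by rewrite /= horner_morphC.
  + by rewrite /= horner_morphX.
  + move=> fp; apply: inj; rewrite -fp -ft /= /horner_morph -horner_map.
    by rewrite -map_poly_comp; congr (_.[_]); apply: eq_map_poly => a /=.
- move=> S g h Qg hC hE; apply: sparse_units_step Qg => [a|p] /=.
    by rewrite hC.
  by rewrite hE -horner_map -map_poly_comp.
have [|G G0 GP] := units 1; first by rewrite rmorph1 oner_eq0.
exists G => // a u eq1; have [s gs] := gsurj u.
by apply: (GP a 0%N s); rewrite /= gs eq1.
Qed.

End NonUnits.

(** * Constants of residue rings *)

Section Constants.
Variables (K : fieldType) (sigma : {rmorphism K -> K}).
Hypotheses (char0 : [pchar K] =i pred0) (CK_closed : alg_closed_in (fixed sigma)).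

Lemma natr_inj : injective (fun i : nat => i%:R : K).
Proof.
have le i j : (i <= j)%N -> i%:R = j%:R :> K -> i = j.
  move=> leij /eqP; rewrite eq_sym -subr_eq0 -natrB // (iffLR (pcharf0P K) char0).
  by rewrite subn_eq0 => leji; apply: anti_leq; rewrite leij.
by move=> i j eqij; case/orP: (leq_total i j) => /le h; [|apply/esym]; apply: h.
Qed.

(** The product of the [X - sigma^i a], [i < m], has coefficients in [C_K], hence a root there; the
    root is a conjugate of [a], and [sigma] is injective. *)
Lemma fixed_of_iter (m : nat) (a : K) :
  (0 < m)%N -> iter m sigma a = a -> fixed sigma a.
Proof.
move=> m_gt0 am; pose p := \prod_(x <- mkseq (fun i => iter i sigma a) m) ('X - x%:P).
have pE : p = \prod_(i < m) ('X - (iter i sigma a)%:P).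
  by rewrite /p /mkseq big_map -{1}[m]subn0 big_mkord.
have [i||x xC] := CK_closed (p := p).
- rewrite /fixed -coef_map; congr (_`_i); rewrite pE rmorph_prod /=.
  under eq_bigr do rewrite map_polyXsubC -iterS.
  case: m m_gt0 am {p pE} => // m _ am.
  by rewrite big_ord_recr big_ord_recl /= mulrC -iterS am.
- by rewrite size_prod_XsubC size_mkseq.
rewrite /p root_prod_XsubC => /mapP[i _ xE].
by move: xC; rewrite xE /fixed -iterS iterSr => /fmorph_inj.
Qed.

Variables (T : comNzRingType) (s : {rmorphism T -> T}) (iota : {rmorphism K -> T}).
Hypotheses (s_simple : sigma_simple s).
Hypothesis s_iota : forall a, s (iota a) = iota (sigma a).
Variables (xs : seq T).
Hypothesis genxs : generates iota xs.
Variables (F : fieldType) (f : {rmorphism T -> F}) (l : nat) (e : T).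
Hypotheses (l_gt0 : (0 < l)%N) (f_l : forall a, f (iter l s a) = 0 <-> f a = 0).
Hypotheses (f_e : f e = 1) (f_ie : forall k, (0 < k < l)%N -> f (iter k s e) = 0).

Let rho : {rmorphism K -> F} := f \o iota.

Lemma iter_sigma_iota m a : iter m s (iota a) = iota (iter m sigma a).
Proof. by elim: m => //= m ->. Qed.

Lemma residue_iter_dvd m a : (l %| m)%N -> f (iter m s a) = 0 <-> f a = 0.
Proof. by move=> /dvdnP[t ->]; apply: residue_iter_mul. Qed.

(** The minimal monic equation of [f c] is unchanged by [sigma^m], since the difference would have
    smaller degree. Its coefficients thus lie in [C_K], where it has a root; by minimality this root
    is [f c]. *)
Lemma algebraic_constant (m : nat) (c : T) (p : {poly K}) :
    (0 < m)%N -> (l %| m)%N -> iter m s c = c ->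
    p != 0 -> (map_poly rho p).[f c] = 0 ->
  exists2 a, fixed sigma a & f c = rho a.
Proof.
move=> m_gt0 lm cm p0 pc.
have ex_k : exists k, `[< exists p : {poly K},
    [/\ p != 0, (map_poly rho p).[f c] = 0 & size p = k] >].
  by exists (size p); apply/asboolP; exists p.
case: (ex_minnP ex_k) => k /asboolP[{p0 pc}p [p0 pc szp]] kmin.
have kminP (q : {poly K}) : (map_poly rho q).[f c] = 0 -> (size q < k)%N -> q = 0.
  move=> qc ltqk; apply/eqP; apply: contraTT ltqk => q0; rewrite -leqNgt.
  by apply: kmin; apply/asboolP; exists q.
pose q := (lead_coef p)^-1 *: p.
have lp0 : lead_coef p != 0 by rewrite lead_coef_eq0.
have q_monic : lead_coef q = 1 by rewrite lead_coefZ mulVf.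
have szq : size q = k by rewrite size_scale ?invr_eq0.
have qc : (map_poly rho q).[f c] = 0.
  by rewrite map_polyZ hornerZ pc mulr0.
have evE (r : {poly K}) : (map_poly rho r).[f c] = f (map_poly iota r).[c].
  by rewrite -horner_map -map_poly_comp.
have q_fixed : map_poly (iter m sigma) q = q.
  apply/eqP; rewrite -subr_eq0; apply/eqP/kminP.
    rewrite rmorphB hornerD hornerN qc subr0 evE.
    rewrite -map_poly_comp (eq_map_poly (g := iter m s \o iota)); last first.
      by move=> a /=; rewrite iter_sigma_iota.
    rewrite map_poly_comp -{1}cm horner_map.
    by apply/(residue_iter_dvd _ lm); rewrite -evE.
  have szq_gt0 : (0 < size q)%N.
    by rewrite size_poly_gt0 -lead_coef_eq0 q_monic oner_eq0.
  rewrite -szq -(prednK szq_gt0) ltnS; apply/leq_sizeP => j.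
  rewrite coefB coef_map /= leq_eqVlt => /predU1P[<-|ltj].
    by rewrite -lead_coefE q_monic rmorph1 subrr.
  rewrite !(nth_default 0 (s := q)) ?rmorph0 ?subrr //;
    exact: leq_trans (leqSpred _) ltj.
have q0 : q != 0 by rewrite -lead_coef_eq0 q_monic oner_eq0.
have q_size : (1 < size q)%N.
  rewrite ltnNge; apply/negP => /size1_polyC qC; move: qc q_monic.
  rewrite qC map_polyC hornerC lead_coefC => /eqP; rewrite fmorph_eq0.
  by move=> /eqP -> /esym/eqP; rewrite oner_eq0.
have [i|a Ca /factor_theorem[r qE]] := CK_closed (p := q) _ q_size.
  by apply: (fixed_of_iter m_gt0); rewrite -[in RHS]q_fixed coef_map.
exists a => //.
have r0 : r != 0 by apply: contraNneq q0 => r0; rewrite qE r0 mul0r.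
move: qc; rewrite qE rmorphM hornerM /= map_polyXsubC hornerXsubC => /eqP.
rewrite mulf_eq0 subr_eq0 => /orP[/eqP rc|/eqP //].
have := kminP r rc; rewrite -szq qE size_Mmonic ?monicXsubC // size_XsubC.
by rewrite addn2 ltnSn => /(_ isT)/eqP; rewrite (negPf r0).
Qed.

(** Otherwise [f c] is transcendental, and simplicity makes [f c - rho a] invertible in the image of
    [f] for each constant [a]: the ideal it generates is stable under [s^m]. The natural numbers
    give more such [a] than [units_generated] allows. *)
Lemma constant_of_residue_algebra (m : nat) (c : T) :
    (0 < m)%N -> (l %| m)%N -> iter m s c = c ->
  exists2 a, fixed sigma a & f c = rho a.
Proof.
move=> m_gt0 lm cm; apply: contrapT => nC.
have inj (p : {poly K}) : (map_poly rho p).[f c] = 0 -> p = 0.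
  move=> pc; apply: contrapT => /eqP p0; apply: nC.
  exact: (algebraic_constant m_gt0 lm cm p0 pc).
have unit_fc a : fixed sigma a -> exists u, (f c - rho a) * f u = 1.
  move=> Ca; pose I x := exists u, f x = (f c - rho a) * f u.
  suff [u fu] : I 1 by exists u; rewrite -fu rmorph1.
  have iter_a : iter m s (iota a) = iota a.
    by rewrite iter_sigma_iota (iter_fix _ Ca).
  apply: (residue_simple s_simple l_gt0 f_l f_e f_ie
    (I := I) (v := c - iota a) m_gt0 lm).
  - move=> b u w [u' uE] [w' wE]; exists (b * u' + w').
    by rewrite !rmorphD !rmorphM uE wE mulrDr mulrCA.
  - move=> x [u uE]; exists (iter m s u); apply/eqP; rewrite -subr_eq0.
    have /(residue_iter_dvd _ lm) : f (x - (c - iota a) * u) = 0.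
      by rewrite rmorphB uE rmorphM rmorphB subrr.
    have -> : iter m s (x - (c - iota a) * u) = iter m s x - (c - iota a) * iter m s u.
      by rewrite rmorphB rmorphM rmorphB /= cm iter_a.
    by rewrite rmorphB rmorphM rmorphB => ->.
  - by move=> x fx; exists 0; rewrite rmorph0 mulr0.
  - by exists 1; rewrite rmorphB rmorph1 mulr1.
  - rewrite rmorphB subr_eq0; apply/eqP => fca; apply: nC.
    by exists a.
have [G G0 Groot] :=
  units_generated (rho := rho) (f := f) genxs (fun=> erefl) (erefl (f c)) inj.
pose rs := mkseq (fun i => i%:R : K) (size G).
suff : (size rs < size G)%N by rewrite size_mkseq ltnn.
apply: max_poly_roots => //; last by apply/mkseq_uniqP => i j _ _; apply: natr_inj.
apply/allP => _ /mapP[i _ ->].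
by have [u uE] := unit_fc i%:R (rmorph_nat sigma i); apply: Groot uE.
Qed.

(** The hypothesis says that [f u / f v] is invariant under [s^m]. Its denominators form a stable
    ideal containing [v], so the quotient is the residue of some [w]. *)
Lemma constant_quotient (m : nat) (u v : T) :
    (0 < m)%N -> (l %| m)%N -> f v != 0 ->
    f (iter m s u * v) = f (u * iter m s v) ->
  exists2 a, fixed sigma a & f u = rho a * f v.
Proof.
move=> m_gt0 lm fv; rewrite !rmorphM => uv; pose I x := exists w, f (x * u) = f (w * v).
have fmv : f (iter m s v) != 0.
  by apply: contraNneq fv => /(residue_iter_dvd _ lm) ->.
have [w] : I 1.
  apply: (residue_simple s_simple l_gt0 f_l f_e f_ie (I := I) (v := v) m_gt0 lm) => //.
  - move=> b x y [x' xE] [y' yE]; exists (b * x' + y').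
    by rewrite !mulrDl !rmorphD -!mulrA ![f (b * _)]rmorphM xE yE.
  - move=> x [w wE]; exists (iter m s w).
    have /(residue_iter_dvd _ lm) : f (x * u - w * v) = 0 by rewrite rmorphB wE subrr.
    have -> : iter m s (x * u - w * v) =
        iter m s x * iter m s u - iter m s w * iter m s v.
      by rewrite rmorphB !rmorphM.
    rewrite rmorphB => /eqP; rewrite subr_eq0 => /eqP.
    rewrite !(rmorphM f) => eq1; apply: (mulIf fmv).
    by rewrite -mulrA -uv mulrA eq1 mulrAC.
  - by move=> x fx; exists 0; rewrite mul0r rmorph0 rmorphM fx mul0r.
  - by exists u; rewrite mulrC.
rewrite mul1r => uE.
have fw : f (iter m s w - w) = 0.
  have /(residue_iter_dvd _ lm) : f (u - w * v) = 0 by rewrite rmorphB uE subrr.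
  have -> : iter m s (u - w * v) = iter m s u - iter m s w * iter m s v.
    by rewrite rmorphB rmorphM.
  rewrite rmorphB rmorphM => /eqP; rewrite subr_eq0 => /eqP eq1.
  apply/eqP; rewrite rmorphB subr_eq0; apply/eqP.
  apply: (mulIf fmv); apply: (mulIf fv).
  by rewrite -eq1 uv uE rmorphM mulrAC.
(* [w] is fixed by [s^m] only modulo the kernel of [f]; the factor [e] removes the other components
   and keeps the residue. *)
have [|a Ca aE] := @constant_of_residue_algebra m (e * w) m_gt0 lm.
  apply/eqP; rewrite -subr_eq0; apply/eqP; apply: (residue_eq0 s_simple (f := f)) => k.
  rewrite [iter m s (e * w)]rmorphM rmorphB !rmorphM rmorphB !rmorphM /= -iterD.
  rewrite !(residue_idem l_gt0 f_l f_e f_ie) dvdn_addl //.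
  have [lk|_] := boolP (l %| k)%N; last by rewrite !mul0r subrr.
  by rewrite !mul1r -!rmorphB; apply/(residue_iter_dvd _ lk).
by exists a => //; rewrite uE rmorphM -aE rmorphM f_e mul1r.
Qed.

End Constants.

(** * Evaluation at matrices *)

Section MatrixEvaluation.
Variables (K : fieldType) (n : nat).

Definition generic_mx (F : nzRingType) : 'M[{mpoly F[n * n]}]_n :=
  vec_mx (\row_k 'X_k).

Section Eval.
Variables (S : comUnitRingType) (iota : {rmorphism K -> S}) (y : 'M[S]_n).

Definition mx_eval_rmorph : {rmorphism {mpoly K[n * n]} -> S} :=
  mmap iota (fun k => mxvec y 0 k).

Lemma mx_evalE p : mx_eval iota y p = mx_eval_rmorph p.
Proof. by []. Qed.

Lemma mx_eval_generic : map_mx mx_eval_rmorph (generic_mx K) = y.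
Proof.
apply: (can_inj mxvecK); apply/rowP=> k.
by rewrite -map_mxvec vec_mxK !mxE /= mmapX mmap1U.
Qed.

Lemma mx_eval_det : mx_eval_rmorph (\det (generic_mx K)) = \det y.
Proof. by rewrite -det_map_mx mx_eval_generic. Qed.

End Eval.

Lemma rmorph_mx_eval (S T : comUnitRingType) (phi : {rmorphism S -> T})
    (iota : {rmorphism K -> S}) (j : {rmorphism K -> T}) (y : 'M[S]_n) p :
  (forall a, phi (iota a) = j a) ->
  phi (mx_eval_rmorph iota y p) = mx_eval_rmorph j (map_mx phi y) p.
Proof.
move=> phi_iota; rewrite /mx_eval_rmorph /= /mmap rmorph_sum; apply: eq_bigr => m _.
rewrite rmorphM phi_iota rmorph_prod; congr (_ * _); apply: eq_bigr => k _.
by rewrite rmorphXn -map_mxvec mxE.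
Qed.

Lemma mx_eval_generic_inj (F : fieldType) (rho : {rmorphism K -> F})
    (p : {mpoly K[n * n]}) :
  mx_eval_rmorph (@mpolyC (n * n) F \o rho) (generic_mx F) p = 0 -> p = 0.
Proof.
move=> pX; apply/mpolyP => m; apply: (fmorph_inj rho); rewrite mcoeff0 rmorph0.
rewrite -(mcoeff_map_mpoly rho) -[RHS](mcoeff0 F m) -pX; congr (_@_m).
rewrite /map_mpoly /mx_eval_rmorph /= /mmap; apply: eq_bigr => m' _.
by congr (_ * _); apply: mmap1_eq => k; rewrite vec_mxK mxE.
Qed.

Section Lift.
Variables (R : comUnitRingType) (iotaR : {rmorphism K -> R}) (Y : 'M[R]_n).
Hypothesis Y_unit : Y \in unitmx.
Hypothesis Y_gen : forall x : R, exists (p : {mpoly K[n * n]}) (k : nat),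
  x = mx_eval iotaR Y p / \det Y ^+ k.

Lemma mx_gen_num x : exists pk : {mpoly K[n * n]} * nat,
  x * \det Y ^+ pk.2 = mx_eval_rmorph iotaR Y pk.1.
Proof.
have [p [k ->]] := Y_gen x; exists (p, k).
by rewrite /= divrK // unitrX // -unitmxE.
Qed.

Lemma rmorph_mx_ext (S : comUnitRingType) (phi psi : {rmorphism R -> S}) :
    (forall a, phi (iotaR a) = psi (iotaR a)) -> map_mx phi Y = map_mx psi Y ->
  phi =1 psi.
Proof.
move=> eqK eqY x; have [[p k] /= xE] := mx_gen_num x.
have dY : phi (\det Y ^+ k) \is a GRing.unit.
  by apply: rmorph_unit; rewrite unitrX // -unitmxE.
apply: (mulIr dY); rewrite -rmorphM xE {1}rmorphXn -det_map_mx eqY det_map_mx.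
rewrite -rmorphXn -rmorphM xE.
by rewrite !(rmorph_mx_eval (j := psi \o iotaR)) ?eqY //= => a; rewrite eqK.
Qed.

Lemma generates_mx :
  generates iotaR ((\det Y)^-1 :: [seq mxvec Y 0 k | k : 'I_(n * n)]).
Proof.
move=> B BK Bxs Bsub Bmul x.
have B0 : B 0 by have := BK 0; rewrite rmorph0.
have B1 : B 1 by have := BK 1; rewrite rmorph1.
have Badd u v : B u -> B v -> B (u + v).
  by move=> Bu Bv; rewrite -[v]opprK -[- v]add0r; apply: (Bsub _ _ Bu); apply: Bsub.
have BX u k : B u -> B (u ^+ k).
  by move=> Bu; elim: k => // k IH; rewrite exprS; apply: Bmul.
have [p [k ->]] := Y_gen x; rewrite -exprVn; apply: (Bmul _ _); last first.
  by apply/BX/Bxs/mem_head.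
apply: (big_ind B) => // m _; apply: (Bmul _ _ (BK _)).
apply: (big_ind B) => // i _; apply/BX/Bxs; rewrite inE; apply/orP; right.
by apply/mapP; exists i => //; rewrite mem_enum.
Qed.

Hypothesis Y_indep : alg_independent iotaR Y.

(** [p(Y) / det(Y)^k] goes to [p(M) / det(M)^k]; [F_val] derives from algebraic independence that
    the choice of [p] and [k] is immaterial. *)
Lemma mx_lift (S : comUnitRingType) (j : {rmorphism K -> S}) (M : 'M[S]_n) :
    M \in unitmx ->
  exists phi : {rmorphism R -> S},
    (forall a, phi (iotaR a) = j a) /\ map_mx phi Y = M.
Proof.
move=> uM; have [num numE] := choice mx_gen_num.
pose evY := mx_eval_rmorph iotaR Y; pose evM := mx_eval_rmorph j M.
pose F x := evM (num x).1 / \det M ^+ (num x).2.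
have udM k : \det M ^+ k \is a GRing.unit by rewrite unitrX // -unitmxE.
have evD k : evY (\det (generic_mx K) ^+ k) = \det Y ^+ k.
  by rewrite rmorphXn /= mx_eval_det.
have evDM k : evM (\det (generic_mx K) ^+ k) = \det M ^+ k.
  by rewrite rmorphXn /= mx_eval_det.
have F_val x p k : x * \det Y ^+ k = evY p -> F x * \det M ^+ k = evM p.
  move=> xp; apply: (mulIr (udM (num x).2)); rewrite /F mulrAC divrK //.
  rewrite -!evDM -!rmorphM; apply: (congr1 evM).
  apply/eqP; rewrite -subr_eq0; apply/eqP.
  apply: Y_indep; rewrite mx_evalE -/evY rmorphB !rmorphM !evD -xp -numE.
  by rewrite mulrAC subrr.
have F_zmod : zmod_morphism F.
  move=> x z; apply: (mulIr (udM ((num x).2 + (num z).2)%N)).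
  pose D := \det (generic_mx K).
  rewrite (F_val _ ((num x).1 * D ^+ (num z).2 - (num z).1 * D ^+ (num x).2)).
    rewrite rmorphB !rmorphM /= !evDM -(F_val _ _ _ (numE x)).
    rewrite -(F_val _ _ _ (numE z)) !exprD mulrBl; congr (_ - _).
      by rewrite mulrA.
    by rewrite mulrCA mulrC mulrA.
  rewrite rmorphB !rmorphM !evD -!numE !exprD mulrBl; congr (_ - _).
    by rewrite mulrA.
  by rewrite mulrCA mulrC.
have F_monoid : monoid_morphism F.
  split=> [|x z].
    by rewrite -[LHS]mulr1 -[X in _ * X](expr0 (\det M)) (F_val _ 1) ?rmorph1 ?mulr1.
  apply: (mulIr (udM ((num x).2 + (num z).2)%N)).
  rewrite (F_val _ ((num x).1 * (num z).1)).
    by rewrite rmorphM -(F_val _ _ _ (numE x)) -(F_val _ _ _ (numE z)) exprD mulrACA.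
  by rewrite rmorphM -!numE exprD mulrACA.
pose phi : {rmorphism R -> S} := HB.pack F
  (GRing.isZmodMorphism.Build R S F F_zmod)
  (GRing.isMonoidMorphism.Build R S F F_monoid).
have phiE x p : x = evY p -> phi x = evM p.
  move=> xE; rewrite -[phi x]mulr1 -[X in _ * X](expr0 (\det M)).
  by rewrite (F_val _ p) // mulr1.
exists phi; split=> [a|].
  by rewrite (phiE _ a%:MP) /evY /evM /mx_eval_rmorph /= mmapC.
rewrite -[LHS]mxvecK -[RHS]mxvecK; congr vec_mx; apply/rowP => k.
rewrite -map_mxvec mxE (phiE _ 'X_k) /evY /evM /mx_eval_rmorph /= mmapX mmap1U //.
Qed.

End Lift.

End MatrixEvaluation.

(** * Density of matrices of natural numbers *)

Section Density.
Variables (F : fieldType) (natF_inj : injective (fun i : nat => i%:R : F)).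

(* The monomials are pairwise distinct characters of the monoid of vectors of
   natural numbers under coordinatewise multiplication: substituting [2 x_i]
   for [x_i] and subtracting [2^(m0 i)] times the relation removes [m0]. *)
Lemma monomials_free (N : nat) (ms : seq 'X_{1..N}) (c : 'X_{1..N} -> F) :
    uniq ms ->
    (forall x : 'I_N -> nat,
      \sum_(m <- ms) c m * \prod_(i < N) (x i)%:R ^+ m i = 0) ->
  forall m, m \in ms -> c m = 0.
Proof.
elim: ms c => // m0 ms IH c /= /andP[m0ms ums] sum0.
have c0 m : m \in ms -> c m = 0.
  move=> mms; have [i mi] : exists i, m i != m0 i.
    apply: contrapT => noi; case/negP: m0ms; suff <- : m = m0 by [].
    apply/mnmP => i; apply: contrapT => /eqP mi; apply: noi.
    by exists i.
  have c2 : 2%:R ^+ m i - 2%:R ^+ m0 i != 0 :> F.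
    rewrite subr_eq0 -!natrX; apply: contraNneq mi => /natF_inj/eqP.
    by rewrite eqn_exp2l.
  have := IH (fun m => c m * (2%:R ^+ m i - 2%:R ^+ m0 i)) ums _ m mms.
  move=> /(_ _)/eqP; rewrite mulf_eq0 (negPf c2) orbF => eq0; apply/eqP/eq0.
  move=> x; pose x' k := (if k == i then 2 * x k else x k)%N.
  have x'E (m' : 'X_{1..N}) : \prod_(k < N) (x' k)%:R ^+ m' k =
      2%:R ^+ m' i * \prod_(k < N) (x k)%:R ^+ m' k :> F.
    rewrite (bigD1 i) //= [in RHS](bigD1 i) //= /x' eqxx natrM exprMn -mulrA.
    congr (_ * (_ * _)).
    by apply: eq_bigr => k /negPf ->.
  have := sum0 x'; have := sum0 x; rewrite !big_cons x'E => s1 s2.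
  under eq_bigr do rewrite mulrBr mulrBl.
  rewrite sumrB; apply/eqP; rewrite subr_eq0; apply/eqP.
  have -> : \sum_(m <- ms) c m * 2%:R ^+ m0 i * \prod_(k < N) (x k)%:R ^+ m k =
      2%:R ^+ m0 i * \sum_(m <- ms) c m * \prod_(k < N) (x k)%:R ^+ m k.
    by rewrite mulr_sumr; apply: eq_bigr => m' _; rewrite mulrA [_ * c m']mulrC.
  move/eqP: s1; rewrite addrC addr_eq0 => /eqP ->.
  move/eqP: s2; rewrite addrC addr_eq0 => /eqP s2.
  rewrite mulrN mulrCA -s2; apply: eq_bigr => m' _.
  by rewrite x'E mulrA.
move=> m; rewrite inE => /predU1P[->|/c0 //].
have := sum0 (fun=> 1%N); rewrite big_cons [X in _ + X]big_seq [X in _ + X]big1.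
  by rewrite addr0 big1 ?mulr1 // => i _; rewrite expr1n.
by move=> m' /c0 ->; rewrite mul0r.
Qed.

Lemma mpoly_nat_eq0 (N : nat) (p : {mpoly F[N]}) :
  (forall x : 'I_N -> nat, p.@[fun i => (x i)%:R] = 0) -> p = 0.
Proof.
move=> px; apply/mpolyP => m; rewrite mcoeff0.
have [/(monomials_free (c := fun m => p@_m) (msupp_uniq p))|] := boolP (m \in msupp p).
  by apply=> x; have := px x; rewrite mevalE.
exact: memN_msupp_eq0.
Qed.

Variables (K : fieldType) (n : nat) (rho : {rmorphism K -> F}).

(** [p(y X) det(X)] vanishes at all matrices of natural numbers, the determinant covering the
    singular ones, so [p(y X) = 0]. Substituting [y^-1 X] for [X] gives [p = 0]. *)
Lemma mx_eval_nat_eq0 (y : 'M[F]_n) (p : {mpoly K[n * n]}) :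
    y \in unitmx ->
    (forall g : 'M[nat]_n, map_mx (fun i => i%:R : F) g \in unitmx ->
      mx_eval_rmorph rho (y *m map_mx (fun i => i%:R) g) p = 0) ->
  p = 0.
Proof.
move=> uy p0; pose X := generic_mx n F.
pose rhoC : {rmorphism K -> {mpoly F[n * n]}} := @mpolyC (n * n) F \o rho.
pose yC := map_mx (@mpolyC (n * n) F) y.
pose q := mx_eval_rmorph rhoC (yC *m X) p.
pose ev (G : 'M[F]_n) : {rmorphism {mpoly F[n * n]} -> F} :=
  meval (fun k => mxvec G 0 k).
have evC G a : ev G a%:MP = a by apply: mevalC.
have evX G : map_mx (ev G) X = G.
  apply: (can_inj mxvecK); apply/rowP => k.
  by rewrite -map_mxvec vec_mxK !mxE /= mevalXU.
have ev_det G : ev G (\det X) = \det G by rewrite -det_map_mx evX.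
have evq G : ev G q = mx_eval_rmorph rho (y *m G) p.
  rewrite /q (rmorph_mx_eval (j := rho)) => [|a]; last by rewrite /= evC.
  rewrite map_mxM evX -map_mx_comp; congr (mx_eval_rmorph rho (_ *m _) p).
  by apply/matrixP => i j; rewrite mxE /= mevalC.
have q0 : q = 0.
  have detX0 : \det X != 0.
    apply/eqP => X0; have := ev_det 1%:M; rewrite X0 rmorph0 det1 => /eqP.
    by rewrite eq_sym oner_eq0.
  apply/eqP; have := mulf_eq0 q (\det X); rewrite (negPf detX0) orbF => <-.
  apply/eqP/mpoly_nat_eq0 => x; pose g : 'M[nat]_n := vec_mx (\row_k x k).
  pose G := map_mx (fun i => i%:R : F) g.
  have -> : (q * \det X).@[fun i => (x i)%:R] = ev G (q * \det X).
    by apply: meval_eq => k; rewrite -map_mxvec vec_mxK !mxE.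
  rewrite rmorphM evq ev_det; have [uG|nuG] := boolP (G \in unitmx).
    by rewrite p0 // mul0r.
  by move: nuG; rewrite unitmxE unitfE negbK => /eqP ->; rewrite mulr0.
pose psi := mx_eval_rmorph (@mpolyC (n * n) F) (invmx yC *m X).
have psiC a : psi a%:MP = a%:MP by rewrite /psi /= mmapC.
have uyC : yC \in unitmx by rewrite map_unitmx.
have : psi q = 0 by rewrite q0 rmorph0.
rewrite /q (rmorph_mx_eval (j := rhoC)) => [|a]; last by rewrite /rhoC /= psiC.
rewrite map_mxM mx_eval_generic -map_mx_comp.
have -> : map_mx (psi \o @mpolyC (n * n) F) y = yC.
  by apply/matrixP => i j; rewrite !mxE /= psiC.
rewrite mulmxA mulmxV // mul1mx => pX.
exact: mx_eval_generic_inj pX.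
Qed.

End Density.

(** * Periodic elements of the fraction field *)

Section FractionLift.
Variable R : idomainType.
Local Notation tofrac := (@FracField.tofrac R).

Lemma fraction_num (a : {fraction R}) :
  exists pq : R * R, pq.2 != 0 /\ a * tofrac pq.2 = tofrac pq.1.
Proof.
elim/quotW: a => x; exists (\n_x, \d_x); split=> /=; first exact: denom_ratioP.
unlock FracField.tofrac; rewrite -[LHS]FracField.pi_mul.
apply/eqmodP; rewrite /= FracField.equivfE /FracField.mulf.
rewrite !numden_Ratio ?mulf_neq0 ?oner_eq0 ?denom_ratioP //.
by rewrite !mulr1 mulrC.
Qed.

Lemma fraction_lift (F : fieldType) (theta : {rmorphism R -> F}) :
    (forall r, theta r = 0 -> r = 0) ->
  exists Theta : {rmorphism {fraction R} -> F}, forall r, Theta (tofrac r) = theta r.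
Proof.
move=> theta_inj; have [num numP] := choice fraction_num.
have theta0 r : r != 0 -> theta r != 0.
  by apply: contra_neq => /theta_inj.
pose G a := theta (num a).1 / theta (num a).2.
have G_val a p q : q != 0 -> a * tofrac q = tofrac p -> G a * theta q = theta p.
  move=> q0 apq; have [n0 an] := numP a.
  rewrite /G mulrAC; apply: (canLR (mulfK (theta0 _ n0))).
  rewrite -!rmorphM; apply: (congr1 theta); apply/eqP; rewrite -tofrac_eq !rmorphM /=.
  by rewrite -an -apq mulrAC.
have G_zmod : zmod_morphism G.
  move=> a b; have [[na ea] [nb eb]] := (numP a, numP b).
  have nab := mulf_neq0 na nb; apply: (mulIf (theta0 _ nab)).
  rewrite (G_val _ ((num a).1 * (num b).2 - (num b).1 * (num a).2)) //.
    rewrite rmorphB !rmorphM -(G_val a _ _ na ea) -(G_val b _ _ nb eb) mulrBl.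
    by congr (_ - _); ring.
  rewrite rmorphB !rmorphM /= -ea -eb mulrBl; congr (_ - _); first by rewrite mulrA.
  by rewrite mulrCA mulrC.
have G_monoid : monoid_morphism G.
  split=> [|a b].
    by rewrite -[LHS]mulr1 -(rmorph1 theta) (G_val _ 1) ?oner_eq0 ?rmorph1 ?mulr1.
  have [[na ea] [nb eb]] := (numP a, numP b).
  have nab := mulf_neq0 na nb; apply: (mulIf (theta0 _ nab)).
  rewrite (G_val _ ((num a).1 * (num b).1)) //.
    by rewrite !rmorphM -(G_val a _ _ na ea) -(G_val b _ _ nb eb) mulrACA.
  by rewrite !rmorphM /= -ea -eb mulrACA.
pose Theta : {rmorphism {fraction R} -> F} := HB.pack G
  (GRing.isZmodMorphism.Build {fraction R} F G G_zmod)
  (GRing.isMonoidMorphism.Build {fraction R} F G G_monoid).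
exists Theta => r; rewrite -[LHS]mulr1 -(rmorph1 theta).
by rewrite (G_val _ r) ?oner_eq0 // rmorph1 mulr1.
Qed.

End FractionLift.

Section PeriodicElements.
Variables (K : fieldType) (sigma : {rmorphism K -> K}).
Hypotheses (char0 : [pchar K] =i pred0) (CK_closed : alg_closed_in (fixed sigma)).
Variables (n : nat) (A : 'M[K]_n).
Variables (R : idomainType) (sigmaR : {rmorphism R -> R})
  (iotaR : {rmorphism K -> R}) (Y : 'M[R]_n).
Hypothesis R_ext : fundamental_extension sigma A sigmaR iotaR Y.
Hypothesis Y_indep : alg_independent iotaR Y.
Variable sigmaL : {rmorphism {fraction R} -> {fraction R}}.
Hypothesis sigmaL_ext : forall r : R, sigmaL (tofrac r) = tofrac (sigmaR r).
Variables (T : comUnitRingType) (s : {rmorphism T -> T}) (iota : {rmorphism K -> T})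
  (y : 'M[T]_n).
Hypotheses (T_ext : fundamental_extension sigma A s iota y) (s_simple : sigma_simple s).
Variables (F : fieldType) (f : {rmorphism T -> F}) (l : nat) (e : T).
Hypotheses (l_gt0 : (0 < l)%N) (f_l : forall a, f (iter l s a) = 0 <-> f a = 0).
Hypotheses (f_e : f e = 1) (f_ie : forall k, (0 < k < l)%N -> f (iter k s e) = 0).

Let natK_inj := natr_inj char0.

Let rho : {rmorphism K -> F} := f \o iota.

Lemma natF_inj : injective (fun i : nat => i%:R : F).
Proof. by move=> i j eqij; apply/natK_inj/(fmorph_inj rho); rewrite !rmorph_nat. Qed.

Lemma iter_sigmaL i r : iter i sigmaL (tofrac r) = tofrac (iter i sigmaR r).
Proof. by elim: i => //= i ->. Qed.

(** The entries of [g] are constants, so [y g] solves the same system as [y] and [Y |-> y g]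
    commutes with the automorphisms. *)
Lemma difference_specialization (g : 'M[nat]_n) :
    map_mx (fun i => i%:R : F) g \in unitmx ->
  exists phi : {rmorphism R -> T},
    [/\ forall a, phi (iotaR a) = iota a,
        map_mx phi Y = y *m map_mx (fun i => i%:R) g &
        forall i r, phi (iter i sigmaR r) = iter i s (phi r)].
Proof.
move=> ug; pose gK := map_mx (fun i => i%:R : K) g.
have ugK : gK \in unitmx.
  rewrite -(map_unitmx rho) -map_mx_comp; congr (_ \in unitmx): ug.
  by apply/matrixP => i j; rewrite !mxE /= !rmorph_nat.
have gT : map_mx (fun i => i%:R : T) g = map_mx iota gK.
  by apply/matrixP => i j; rewrite !mxE rmorph_nat.
have uM : y *m map_mx (fun i => i%:R) g \in unitmx.
  rewrite unitmx_mul (fundext_unit T_ext) gT unitmxE det_map_mx rmorph_unit //.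
have [phi [phiK phiY]] :=
  mx_lift (fundext_unit R_ext) (fundext_gen R_ext) Y_indep iota uM.
exists phi; split=> //.
have phi_s : phi \o sigmaR =1 s \o phi.
  apply: (rmorph_mx_ext (fundext_unit R_ext) (fundext_gen R_ext)) => [a|] /=.
    by rewrite (fundext_iota R_ext) !phiK (fundext_iota T_ext).
  have -> : map_mx (phi \o sigmaR) Y = map_mx phi (map_mx sigmaR Y).
    by apply/matrixP => i j; rewrite !mxE.
  have -> : map_mx (s \o phi) Y = map_mx s (map_mx phi Y).
    by apply/matrixP => i j; rewrite !mxE.
  rewrite (fundext_eq R_ext) map_mxM !phiY map_mxM (fundext_eq T_ext) -mulmxA.
  have -> : map_mx phi (map_mx iotaR A) = map_mx iota A.
    by apply/matrixP => i j; rewrite !mxE phiK.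
  have -> // : map_mx s (map_mx (fun i => i%:R) g) = map_mx (fun i => i%:R) g.
  by apply/matrixP => i j; rewrite !mxE rmorph_nat.
by elim=> //= i IH r; rewrite [LHS]phi_s /= IH.
Qed.

Lemma specialization_eq0 (h : R) :
    (forall phi : {rmorphism R -> T}, (forall a, phi (iotaR a) = iota a) ->
      (forall i r, phi (iter i sigmaR r) = iter i s (phi r)) -> f (phi h) = 0) ->
  h = 0.
Proof.
move=> h0; have [[p k] /= hE] := mx_gen_num (fundext_unit R_ext) (fundext_gen R_ext) h.
suff p0 : p = 0.
  have dY : \det Y ^+ k \is a GRing.unit.
    by rewrite unitrX // -unitmxE (fundext_unit R_ext).
  by apply: (mulIr dY); rewrite hE p0 rmorph0 mul0r.
apply: (@mx_eval_nat_eq0 F natF_inj K n rho (map_mx f y)) => [|g ug].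
  by rewrite unitmxE det_map_mx rmorph_unit // -unitmxE (fundext_unit T_ext).
have [phi [phiK phiY phi_s]] := difference_specialization ug.
have := congr1 (f \o phi) hE; rewrite /= !rmorphM h0 // mul0r => /esym.
rewrite (rmorph_mx_eval (j := iota) _ _ phiK) phiY.
rewrite (rmorph_mx_eval (j := rho)) // map_mxM -map_mx_comp => eq0.
rewrite -[RHS]eq0; congr (mx_eval_rmorph rho (_ *m _) p).
by apply/matrixP => i j; rewrite !mxE /= rmorph_nat.
Qed.

Lemma periodic_iter (a : {fraction R}) : periodic sigmaL a -> iter l sigmaL a = a.
Proof.
(* The period is replaced by a multiple of [l], so that [s^m] preserves the kernel of [f]. *)
case=> d [d_gt0 ad]; pose m := (l * d)%N.
have m_gt0 : (0 < m)%N by rewrite muln_gt0 l_gt0.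
have lm : (l %| m)%N by apply: dvdn_mulr.
have am : iter m sigmaL a = a by apply: iter_period ad l.
have [[p q] /= [q0 aq]] := fraction_num a.
have iter_aq i : iter i sigmaL a * tofrac (iter i sigmaR q) = tofrac (iter i sigmaR p).
  by rewrite -!iter_sigmaL -aq rmorphM.
have pq_m : iter m sigmaR p * q = p * iter m sigmaR q.
  apply/eqP; rewrite -tofrac_eq !rmorphM /=; apply/eqP.
  by rewrite -iter_aq -aq am mulrAC.
have pq_l : iter l sigmaR p * q - p * iter l sigmaR q = 0.
  apply: specialization_eq0 => phi phiK phi_s.
  have fl x : f (phi x) = 0 -> f (phi (iter l sigmaR x)) = 0.
    by rewrite phi_s => fx; apply/f_l.
  rewrite rmorphB rmorphB !rmorphM.
  have [fq|fq] := eqVneq (f (phi q)) 0; first by rewrite fq (fl q fq) !mulr0 subrr.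
  have phi_pq : f (iter m s (phi p) * phi q) = f (phi p * iter m s (phi q)).
    by rewrite -!phi_s -!(rmorphM phi) pq_m.
  (* The residue of [phi p] is a constant [b] times that of [phi q]; applying [s^l] to
     [phi p - b * phi q] in the kernel of [f] gives the same ratio. *)
  have [b Cb pE] := constant_quotient char0 CK_closed s_simple (fundext_iota T_ext)
    (generates_mx (fundext_gen T_ext)) l_gt0 f_l f_e f_ie
    m_gt0 lm fq phi_pq.
  have : f (phi p - iota b * phi q) = 0.
    by rewrite rmorphB pE rmorphM subrr.
  move/f_l; have -> : iter l s (phi p - iota b * phi q) =
      phi (iter l sigmaR p) - iota b * phi (iter l sigmaR q).
    rewrite rmorphB rmorphM /= -!phi_s (iter_sigma_iota (fundext_iota T_ext)).
    by rewrite (iter_fix _ Cb).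
  rewrite rmorphB rmorphM => /eqP; rewrite subr_eq0 => /eqP ->.
  by rewrite pE /=; ring.
have iq0 i : tofrac (iter i sigmaR q) != 0.
  rewrite -iter_sigmaL; elim: i => [|i IH] /=; first by rewrite tofrac_eq0.
  by rewrite fmorph_eq0.
apply: (mulIf (iq0 l)); apply: (mulIf (iq0 0%N)) => /=.
rewrite iter_aq mulrAC aq -!rmorphM; congr tofrac.
by apply/eqP; rewrite -subr_eq0 pq_l.
Qed.

End PeriodicElements.

(** * Degree of the field of periodic elements *)

Section CyclicDegree.
Variables (L : fieldType) (sigmaL : {rmorphism L -> L}) (l : nat).
Hypothesis l_gt0 : (0 < l)%N.
Hypothesis periodic_l : forall a, periodic sigmaL a -> iter l sigmaL a = a.

Let iter_modn i a : iter l sigmaL a = a -> iter (i %% l) sigmaL a = iter i sigmaL a.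
Proof. by move=> al; rewrite [in RHS](divn_eq i l) addnC iterD iter_period. Qed.

(** Galois descent: [mu_free] selects [l] elements [b r] whose conjugates form an invertible matrix.
    The coordinates of [x] solve the system given by all conjugates of [x]; [sigmaL] permutes its
    equations cyclically, so uniqueness makes the coordinates fixed. *)
Lemma cyclic_degree (I : finType) (mu : I -> L) :
    (forall r, iter l sigmaL (mu r) = mu r) ->
    (forall v : 'I_l -> L, (forall r, \sum_i v i * iter i sigmaL (mu r) = 0) ->
       forall i, v i = 0) ->
  has_degree (periodic sigmaL) (fixed sigmaL) l.
Proof.
move=> mu_l mu_free.
pose Lam : 'M[L]_(#|I|, l) := \matrix_(r, i) iter i sigmaL (mu (enum_val r)).
have Lam_full : row_full Lam.
  rewrite /row_full -mxrank_tr; apply: inj_row_free => v vL.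
  apply/rowP => i; rewrite mxE; apply: (mu_free (fun i => v 0 i)) => r.
  have := congr1 (fun M : 'rV_#|I| => M 0 (enum_rank r)) vL; rewrite !mxE => sum0.
  rewrite -[RHS]sum0; by apply: eq_bigr => k _; rewrite !mxE enum_rankK.
pose W := rowsub (fullrankfun Lam_full) Lam.
have uW : W \in unitmx by apply: fullrowsub_unit.
pose b r := mu (enum_val (fullrankfun Lam_full r)).
have WE (c : 'I_l -> L) i : (\row_r c r *m W) 0 i = \sum_r c r * iter i sigmaL (b r).
  by rewrite mxE; apply: eq_bigr => r _; rewrite !mxE.
have W_inj (c c' : 'I_l -> L) :
    (forall i : 'I_l, \sum_r c r * iter i sigmaL (b r) =
      \sum_r c' r * iter i sigmaL (b r)) -> c =1 c'.
  move=> eqc r; have /(can_inj (mulmxK uW)) : \row_r c r *m W = \row_r c' r *m W.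
    by apply/rowP => i; rewrite !WE.
  by move/rowP/(_ r); rewrite !mxE.
have b_l r : iter l sigmaL (b r) = b r by apply: mu_l.
exists b; split=> [r|x /periodic_l xl|c Cc cb].
- by exists l.
- pose c r := ((\row_(i < l) iter i sigmaL x) *m invmx W) 0 r.
  have cE_ord (i : 'I_l) : \sum_r c r * iter i sigmaL (b r) = iter i sigmaL x.
    rewrite -WE (_ : \row_r c r = (\row_(i < l) iter i sigmaL x) *m invmx W).
      by rewrite mulmxKV // mxE.
    by apply/rowP => r; rewrite mxE.
  have cE i : \sum_r c r * iter i sigmaL (b r) = iter i sigmaL x.
    have ltil : (i %% l < l)%N by rewrite ltn_mod.
    rewrite -(iter_modn i xl) -(cE_ord (Ordinal ltil)).
    by apply: eq_bigr => r _ /=; rewrite iter_modn.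
  exists c => [r|]; last by rewrite -[LHS](cE 0%N).
  apply: (W_inj (fun r => sigmaL (c r))) => {r} i.
  (* [sigmaL] takes the equation of index [i + l - 1] to that of index [i]. *)
  have shift a : iter l sigmaL a = a ->
      sigmaL (iter (i + l.-1) sigmaL a) = iter i sigmaL a.
    by move=> al; rewrite -iterS -addnS prednK // iterD al.
  rewrite cE -(shift x xl) -cE rmorph_sum; apply: eq_bigr => r _.
  by rewrite rmorphM shift.
- apply: (W_inj c (fun=> 0)) => i; rewrite [RHS]big1 => [|r _]; last by rewrite mul0r.
  have := congr1 (iter i sigmaL) cb; rewrite rmorph0 rmorph_sum => cb_i.
  rewrite -[RHS]cb_i.
  by apply: eq_bigr => r _; rewrite rmorphM /= (iter_fix _ (Cc r)).
Qed.

End CyclicDegree.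

(** * A common extension of [L] and a residue field *)

Section Amalgam.
Variables (K : fieldType) (sigma : {rmorphism K -> K}) (n : nat) (A : 'M[K]_n).
Variables (R : idomainType) (sigmaR : {rmorphism R -> R})
  (iotaR : {rmorphism K -> R}) (Y : 'M[R]_n).
Hypothesis R_ext : fundamental_extension sigma A sigmaR iotaR Y.
Hypothesis Y_indep : alg_independent iotaR Y.
Variables (F0 : fieldType) (rho : {rmorphism K -> F0}).

(** In [F = F0(X)] with [X] generic, [Y |-> X] is injective on [R] and extends to fractions. *)
Lemma amalgam :
  exists (F : fieldType) (j : {rmorphism F0 -> F})
    (theta : {rmorphism {fraction R} -> F}),
    forall a, theta (tofrac (iotaR a)) = j (rho a).
Proof.
pose P := {mpoly F0[n * n]}; pose F := {fraction P}.
pose j : {rmorphism F0 -> F} := @FracField.tofrac P \o @mpolyC (n * n) F0.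
pose M := map_mx (@FracField.tofrac P) (generic_mx n F0).
have uM : M \in unitmx.
  rewrite unitmxE unitfE det_map_mx tofrac_eq0; apply/eqP => X0.
  have := mx_eval_det idfun (1%:M : 'M[F0]_n); rewrite X0 rmorph0 det1 => /eqP.
  by rewrite eq_sym oner_eq0.
have [phi [phiK phiY]] :=
  mx_lift (fundext_unit R_ext) (fundext_gen R_ext) Y_indep (j \o rho) uM.
have phi_inj r : phi r = 0 -> r = 0.
  have [[p k] /= rE] := mx_gen_num (fundext_unit R_ext) (fundext_gen R_ext) r.
  move=> r0; have := congr1 phi rE; rewrite rmorphM r0 mul0r => /esym.
  rewrite (rmorph_mx_eval _ _ phiK) phiY /M.
  have jE a : FracField.tofrac (mpolyC (n * n) (rho a)) = (j \o rho) a by [].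
  rewrite -(rmorph_mx_eval (phi := @FracField.tofrac P)
    (iota := @mpolyC (n * n) F0 \o rho) _ _ jE) => /eqP.
  rewrite tofrac_eq0 => /eqP pX.
  have p0 : p = 0 by exact: mx_eval_generic_inj pX.
  have dY : \det Y ^+ k \is a GRing.unit.
    by rewrite unitrX // -unitmxE (fundext_unit R_ext).
  by apply: (mulIr dY); rewrite rE p0 rmorph0 mul0r.
have [theta thetaE] := fraction_lift phi_inj.
by exists F, j, theta => a; rewrite thetaE phiK.
Qed.

End Amalgam.

(** * Shortest expressions of sequences *)

Section Descent.
Variables (L F : fieldType) (sigmaL : {rmorphism L -> L}) (theta : {rmorphism L -> F}).

Definition represents (u : nat -> F) (z : seq (L * F)) : Prop :=
  forall i, u i = \sum_(t <- z) theta (iter i sigmaL t.1) * t.2.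

Lemma represents_sub u v z w :
  represents u z -> represents v w ->
  represents (fun i => u i - v i) (z ++ [seq (- t.1, t.2) | t <- w]).
Proof.
move=> uz vw i; rewrite uz vw big_cat big_map /=; congr (_ + _).
by rewrite -sumrN; apply: eq_bigr => t _; rewrite !rmorphN mulNr.
Qed.

Lemma represents_mul u v z w :
  represents u z -> represents v w ->
  represents (fun i => u i * v i) [seq (t.1 * r.1, t.2 * r.2) | t <- z, r <- w].
Proof.
move=> uz vw i; rewrite uz vw big_allpairs_dep big_distrlr /=.
by do 2![apply: eq_bigr => ? _]; rewrite !rmorphM mulrACA.
Qed.

(* In a shortest expression a nontrivial relation among the [b j] would allow
   eliminating one of them: this replaces linear disjointness from constants. *)
Lemma minimal_representation u :
    (exists z, represents u z) ->
  exists (N : nat) (lam : 'I_N -> L) (b : 'I_N -> F),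
    (forall i, u i = \sum_j theta (iter i sigmaL (lam j)) * b j) /\
    forall x : 'I_N -> L,
      (forall i, \sum_j theta (iter i sigmaL (x j)) * b j = 0) -> forall j, x j = 0.
Proof.
case=> z uz.
pose P N := `[< exists lam : 'I_N -> L, exists b : 'I_N -> F,
    forall i, u i = \sum_j theta (iter i sigmaL (lam j)) * b j >].
have ex_N : exists N, P N.
  exists (size z); apply/asboolP.
  exists (fun j => (tnth (in_tuple z) j).1), (fun j => (tnth (in_tuple z) j).2).
  by move=> i; rewrite uz big_tnth.
case: (ex_minnP ex_N) => N /asboolP[lam [b ub]] Nmin.
exists N, lam, b; split=> // x x_rel j; apply: contrapT => /eqP xj.
case: N => [|N] in lam b ub Nmin x x_rel j xj *; first by case: j {xj}.
suff : P N by move/Nmin; rewrite ltnn.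
(* [b j] is eliminated by the relation. As it holds for every [i], the same new coefficients in [L]
   serve all [i]. *)
apply/asboolP; exists (fun k => lam (lift j k) - lam j * x (lift j k) / x j).
exists (fun k => b (lift j k)) => i; rewrite ub (bigD1_ord j) //=.
under [in RHS]eq_bigr => k _ do
  rewrite rmorphB 2!rmorphM fmorphV rmorphB 2!rmorphM fmorphV mulrBl.
rewrite sumrB [LHS]addrC; congr (_ + _).
have xj0 : theta (iter i sigmaL (x j)) != 0 by rewrite !fmorph_eq0.
have := x_rel i; rewrite (bigD1_ord j) //= => /eqP; rewrite addr_eq0 => /eqP bj.
have -> : b j = - (\sum_(k < N) theta (iter i sigmaL (x (lift j k))) * b (lift j k)) /
    theta (iter i sigmaL (x j)).
  by apply: (canRL (mulfK xj0)); rewrite mulrC.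
rewrite mulNr mulrN; congr (- _); rewrite mulr_suml mulr_sumr; apply: eq_bigr => k _.
by ring.
Qed.

End Descent.

(** * Independence of the embeddings *)

Section LowerBound.
Variables (K : fieldType) (sigma : {rmorphism K -> K}) (n : nat) (A : 'M[K]_n).
Variables (R : idomainType) (sigmaR : {rmorphism R -> R})
  (iotaR : {rmorphism K -> R}) (Y : 'M[R]_n).
Hypothesis R_ext : fundamental_extension sigma A sigmaR iotaR Y.
Variable sigmaL : {rmorphism {fraction R} -> {fraction R}}.
Hypothesis sigmaL_ext : forall r : R, sigmaL (tofrac r) = tofrac (sigmaR r).
Variables (T : comUnitRingType) (s : {rmorphism T -> T}) (iota : {rmorphism K -> T})
  (y : 'M[T]_n).
Hypothesis T_ext : fundamental_extension sigma A s iota y.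
Variables (F : fieldType) (f : {rmorphism T -> F})
  (theta : {rmorphism {fraction R} -> F}).
Hypothesis theta_iota : forall a, theta (tofrac (iotaR a)) = f (iota a).

Lemma iter_theta_iota i a :
  f (iter i s (iota a)) = theta (iter i sigmaL (tofrac (iotaR a))).
Proof.
rewrite (iter_sigma_iota (fundext_iota T_ext)) -theta_iota.
by apply: (congr1 theta); elim: i => //= i <-; rewrite sigmaL_ext (fundext_iota R_ext).
Qed.

Let YL := map_mx (@FracField.tofrac R) Y.
Let X := invmx (map_mx theta YL) *m map_mx f y.

Lemma YL_unit : YL \in unitmx.
Proof. by rewrite unitmxE det_map_mx rmorph_unit // -unitmxE (fundext_unit R_ext). Qed.

(** Each step multiplies both solutions on the left by the same conjugate of [A], so [X] does not
    depend on [i]; no endomorphism of [F] is involved. *)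
Lemma iter_fundamental i :
  map_mx (f \o iter i s) y = map_mx (theta \o iter i sigmaL) YL *m X.
Proof.
elim: i => [|i IH].
  rewrite /X mulmxA (_ : map_mx (theta \o iter 0 sigmaL) YL = map_mx theta YL).
    rewrite mulmxV ?map_unitmx ?YL_unit // mul1mx.
    by apply/matrixP => a b; rewrite !mxE.
  by apply/matrixP => a b; rewrite !mxE.
have -> : map_mx (f \o iter i.+1 s) y = map_mx (f \o iter i s) (map_mx s y).
  by apply/matrixP => a b; rewrite !mxE /= -iterSr.
have -> : map_mx (theta \o iter i.+1 sigmaL) YL =
    map_mx (theta \o iter i sigmaL) (map_mx (@FracField.tofrac R) (map_mx sigmaR Y)).
  by apply/matrixP => a b; rewrite !mxE /= -iterS iterSr sigmaL_ext.
rewrite (fundext_eq T_ext) (fundext_eq R_ext) !map_mxM IH -mulmxA; congr (_ *m _).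
by apply/matrixP => a b; rewrite !mxE /= iter_theta_iota.
Qed.

(** The elements with such an expression form a subring. [iter_fundamental] puts the entries of [y]
    in it and, by determinants, [1 / det y]. *)
Lemma representable (r : T) :
  exists z, represents sigmaL theta (fun i => f (iter i s r)) z.
Proof.
have X_unit : X \in unitmx.
  rewrite unitmx_mul unitmx_inv map_unitmx YL_unit unitmxE det_map_mx rmorph_unit //.
  by rewrite -unitmxE (fundext_unit T_ext).
pose B r := exists z, represents sigmaL theta (fun i => f (iter i s r)) z.
suff : forall r, B r by apply.
apply: (generates_mx (fundext_gen T_ext) (B := B)) => [a|x||].
- exists [:: (tofrac (iotaR a), 1)] => i.
  by rewrite big_seq1 mulr1 iter_theta_iota.
- rewrite inE => /predU1P[->|/mapP[k _ ->]].
    exists [:: ((\det YL)^-1, (\det X)^-1)] => i.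
    have y_det : iter i s (\det y) \is a GRing.unit.
      by apply: rmorph_unit; rewrite -unitmxE (fundext_unit T_ext).
    have := congr1 determinant (iter_fundamental i).
    rewrite det_mulmx !det_map_mx /= => det_i.
    rewrite big_seq1 /= rmorphV -?unitmxE ?(fundext_unit T_ext) //.
    by rewrite rmorphV // det_i !fmorphV invfM.
  case/mxvec_indexP: k => a c; rewrite mxvecE.
  exists [seq (YL a k, X k c) | k <- enum 'I_n] => i; rewrite big_map big_enum /=.
  have /matrixP/(_ a c) := iter_fundamental i; rewrite mxE => yE.
  rewrite [LHS]yE mxE; apply: eq_bigr => k _; congr (_ * _).
  by rewrite mxE.
- move=> u v [z uz] [w vw]; eexists => i.
  rewrite !rmorphB; exact: represents_sub uz vw i.
- move=> u v [z uz] [w vw]; eexists => i.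
  rewrite !rmorphM; exact: represents_mul uz vw i.
Qed.

Variables (l : nat) (e : T).
Hypotheses (l_gt0 : (0 < l)%N) (f_l : forall a, f (iter l s a) = 0 <-> f a = 0).
Hypotheses (f_e : f e = 1) (f_ie : forall k, (0 < k < l)%N -> f (iter k s e) = 0).
Hypothesis periodic_l : forall a, periodic sigmaL a -> iter l sigmaL a = a.

Lemma periodic_degree : has_degree (periodic sigmaL) (fixed sigmaL) l.
Proof.
have [N [lam [b [eE lam_free]]]] := minimal_representation (representable e).
(* The residues of the conjugates of [e] have period [l]; shifting by [l] gives a second expression
   with the same [b j], and [lam_free] applies to the difference. *)
have lam_l j : iter l sigmaL (lam j) = lam j.
  apply/eqP; rewrite -subr_eq0; apply/eqP; move: j.
  apply: (lam_free (fun j => iter l sigmaL (lam j) - lam j)) => i.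
  have := residue_idem l_gt0 f_l f_e f_ie (i + l).
  rewrite dvdn_addl // -(residue_idem l_gt0 f_l f_e f_ie) !eE => /eqP.
  rewrite -subr_eq0 -sumrB => /eqP eq0; rewrite -[RHS]eq0; apply: eq_bigr => j _.
  by rewrite 2!rmorphB mulrBl iterD.
pose mu (kj : 'I_l * 'I_N) := iter kj.1 sigmaL (lam kj.2).
apply: (cyclic_degree l_gt0 periodic_l (mu := mu)) => [[k j]|v v0 i].
  by rewrite /mu iter_comm lam_l.
(* For this [k], the residue of [s^(i' + k) e] is 0 unless [i' = i]; summing the relations with
   weights [b j] isolates [v i]. *)
have [k ltkl lik] := dvdn_add_complement i l_gt0.
apply: (fmorph_inj theta); rewrite rmorph0.
have term (i' : 'I_l) :
    \sum_j theta (v i' * iter i' sigmaL (mu (Ordinal ltkl, j))) * b j =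
    theta (v i') * (l %| i' + k)%N%:R.
  rewrite -(residue_idem l_gt0 f_l f_e f_ie) eE mulr_sumr; apply: eq_bigr => j _.
  by rewrite rmorphM /mu -iterD mulrA.
have : \sum_j theta (\sum_i v i * iter i sigmaL (mu (Ordinal ltkl, j))) * b j = 0.
  by apply: big1 => j _; rewrite v0 rmorph0 mul0r.
under eq_bigr => j _ do rewrite rmorph_sum mulr_suml.
rewrite exchange_big /= => sum0; rewrite -[RHS]sum0 (bigD1 i) //= term lik mulr1.
rewrite big1 ?addr0 // => i' neq; rewrite term.
have [li'k|_] := boolP (l %| _)%N; last by rewrite mulr0.
case/eqP: neq; apply: val_inj => /=; apply/eqP.
rewrite -(modn_small (ltn_ord i)) -(modn_small (ltn_ord i')) -(eqn_modDr k).
by move: lik li'k; rewrite /dvdn => /eqP -> /eqP ->.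
Qed.

End LowerBound.

Theorem corollary4p13
  (K : fieldType) (sigma : {rmorphism K -> K})
  (sigma_bij : bijective sigma)
  (char0 : [pchar K] =i pred0)
  (CK_closed : alg_closed_in (fixed sigma))
  (n : nat) (A : 'M[K]_n) (A_unit : A \in unitmx)
  (* R = K[Y, 1/det Y], with sigma(Y) = A Y *)
  (R : idomainType) (sigmaR : {rmorphism R -> R})
  (iotaR : {rmorphism K -> R}) (Y : 'M[R]_n)
  (R_ext : fundamental_extension sigma A sigmaR iotaR Y)
  (Y_indep : alg_independent iotaR Y)
  (* the extension of sigma to L = Frac(R) *)
  (sigmaL : {rmorphism {fraction R} -> {fraction R}})
  (sigmaL_ext : forall r : R, sigmaL (tofrac r) = tofrac (sigmaR r))
  (R' : comUnitRingType) (sigmaR' : {rmorphism R' -> R'})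
  (iotaR' : {rmorphism K -> R'})
  (R'_PV : picard_vessiot sigma A sigmaR' iotaR') :
  exists l : nat,
    has_card (@primitive_idempotent R') l /\
    has_degree (periodic sigmaL) (fixed sigmaL) l.
Proof.
have [[y T_ext] s_simple] := R'_PV.
have noeT := noetherian_generated (generates_mx (fundext_gen T_ext)).
have [x [e [l [[x0 l_gt0] x_prime x_l xe xie]]]] :=
  cyclic_prime (fundext_bij T_ext) s_simple noeT.
pose P a := a * x = 0.
have P0 : P 0 by rewrite /P mul0r.
have P1 : ~ P 1 by rewrite /P mul1r; apply/eqP.
have PD a u v : P u -> P v -> P (a * u + v).
  by rewrite /P => Pu Pv; rewrite mulrDl -mulrA Pu Pv mulr0 addr0.
have [F0 [f0 f0P]] := residue_field P0 P1 PD x_prime.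
(* The residue field is enlarged to receive [L]; [j] is injective, so the kernel is still the
   annihilator of [x]. *)
have [F [j [theta theta_iota]]] := amalgam R_ext Y_indep (f0 \o iotaR').
pose f : {rmorphism R' -> F} := j \o f0.
have fP a : f a = 0 <-> a * x = 0.
  rewrite -[_ * x = 0]/(P a) -f0P; split=> [/eqP|/= ->]; last by rewrite rmorph0.
  by rewrite fmorph_eq0 => /eqP.
have f_l a : f (iter l sigmaR' a) = 0 <-> f a = 0.
  by split=> /fP /x_l /fP.
have f_e : f e = 1.
  by apply/esym/eqP; rewrite -subr_eq0 -(rmorph1 f) -rmorphB; apply/eqP/fP.
have f_ie k : (0 < k < l)%N -> f (iter k sigmaR' e) = 0.
  by move=> /xie /fP.
exists l; split; first exact: (card_primitive_idempotents s_simple l_gt0 f_l f_e f_ie).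
apply: (periodic_degree R_ext sigmaL_ext T_ext (f := f) theta_iota l_gt0 f_l f_e f_ie).
exact: (periodic_iter char0 CK_closed R_ext Y_indep sigmaL_ext T_ext s_simple
  l_gt0 f_l f_e f_ie).
Qed.
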